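(* Let $W$ be a finite Coxeter group of rank $n$ with exponents $m_1,\dots,m_n$, let $id$ be its identity element, and let $x\ne0$ be real. Then $$M_{W,x}(id)=\frac{\prod_{i=1}^n(x+m_i)}{x^n|W|}.$$
   Context: Let $W$ be a finite Coxeter group acting on its reflection representation $V$, with a root system and a set $\Pi$ of simple (fundamental) roots, $n=|\Pi|$. For $w\in W$ let $D(w)\subseteq\Pi$ be the set of simple roots mapped by $w$ to negative roots. For $J\subseteq\Pi$ let $X_J=\{w\in W: D(w)\cap J=\emptyset\}$ and $x_J=\sum_{w\in X_J}w$ in the group algebra of $W$. Call $K_1,K_2\subseteq\Pi$ equivalent if $w(K_1)=K_2$ for some $w\in W$; let $\lambda$ range over equivalence classes of subsets of $\Pi$, let $\lambda_K$ be the class of $K$, let $|\lambda|$ be the number of subsets in $\lambda$, and let $\|\lambda\|=|K|$ for any $K\in\lambda$. For $K\subseteq J\subseteq \Pi$ put $\mu_K^J=\frac{|\{w\in X_J: w(K)\subseteq\Pi\}|}{|\lambda_K|}$, and $\mu_K^J=0$ if $K\not\subseteq J$. The matrix $(\mu_K^J)$ is triangular with respect to inclusion with nonzero diagonal, hence invertible; let $(\beta_K^J)$ be its inverse. Define $$e_J=\sum_{K\subseteq J}\beta_K^J x_K,\qquad e_\lambda=\sum_{J\in\lambda}\frac{e_J}{|\lambda|}$$ (equivalently, the $e_J$ are determined by $x_J=\sum_{K\subseteq J}\mu_K^J e_K$ for all $J\subseteq\Pi$). For real $x\ne 0$ define $$M_{W,x}=\sum_{\lambda}\frac{e_\lambda}{x^{\|\lambda\|}},$$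 and let $M_{W,x}(w)$ be the coefficient of $w$ in $M_{W,x}$. The exponents of $W$ are the degrees of its basic polynomial invariants minus one. *)

(* Defs.v *)
From HB Require Import structures.
From mathcomp Require Import all_boot all_order all_algebra all_fingroup.
From mathcomp Require Import all_character.
From mathcomp Require Import reals.
From mathcomp Require Import mpoly.

Set Implicit Arguments.
Unset Strict Implicit.
Unset Printing Implicit Defensive.

Import Order.TTheory GRing.Theory Num.Theory.
Local Open Scope ring_scope.

(* The last clause says that the relations (s_i s_j)^{m_ij} = 1, with m_ij the
   order of s_i s_j, present W; as m_ii = 1, they include s_i^2 = 1. *)
Definition is_coxeter_system (n : nat) (W : finGroupType) (s : 'I_n -> W) :
    Prop :=
  [/\ injective s,
      forall i, #[s i]%g = 2%N,
      << [set s i | i : 'I_n] >>%g = [set: W]%g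
    & forall (G : groupType) (f : 'I_n -> G),
        (forall i j, ((f i * f j) ^+ #[s i * s j])%g = 1%g) ->
        exists phi : W -> G,
          {morph phi : a b / (a * b)%g} /\ forall i, phi (s i) = f i].

Section Euclidean.
Variables (R : realType) (n : nat).
Implicit Types (B : 'M[R]_n) (u v a : 'cV[R]_n).

Definition inner B u v : R := (u^T *m B *m v) ord0 ord0.

Definition is_inner_product B : Prop :=
  B^T = B /\ forall v, v != 0 -> 0 < inner B v v.

Definition reflection B a v : 'cV[R]_n :=
  v - (2 * inner B v a / inner B a a) *: a.

Definition is_root_system B (Phi : seq 'cV[R]_n) : Prop :=
  [/\ 0 \notin Phi,
      forall a (c : R), a \in Phi -> (c *: a \in Phi) = (c == 1) || (c == -1)
    & forall a b, a \in Phi -> b \in Phi -> reflection B a b \in Phi].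

Definition nonneg_comb (alpha : n.-tuple 'cV[R]_n) v : bool :=
  [forall i, 0 <= coord alpha i v].

Definition is_simple_system (Phi : seq 'cV[R]_n) (alpha : n.-tuple 'cV[R]_n) :
    Prop :=
  [/\ basis_of {:'cV[R]_n} alpha,
      {subset alpha <= Phi}
    & forall v, v \in Phi -> nonneg_comb alpha v || nonneg_comb alpha (- v)].

End Euclidean.

(* A finite Coxeter system (W, s) of rank n with its reflection representation
   on V = R^n, a root system Phi and the simple roots alpha_0, .., alpha_(n-1).
   The inner product is given by an arbitrary Gram matrix, so that both the
   geometric representation (alpha the standard basis, Gram matrix
   -cos (pi / m_ij)) and R^n with the dot product are instances.  Elements of V
   are columns and w acts on the left, by v |-> cx_rep w *m v. *)
Record coxeter_data (R : realType) (n : nat) (W : finGroupType) := CoxeterData {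
  cx_gen : 'I_n -> W;
  cx_gram : 'M[R]_n;
  cx_rep : mx_representation R [set: W]%G n;
  cx_root : seq 'cV[R]_n;
  cx_simple : n.-tuple 'cV[R]_n;
  cx_system : is_coxeter_system cx_gen;
  cx_inner : is_inner_product cx_gram;
  cx_faithful : mx_faithful cx_rep;
  cx_rootP : is_root_system cx_gram cx_root;
  cx_simpleP : is_simple_system cx_root cx_simple;
  cx_genE : forall (i : 'I_n) (v : 'cV[R]_n),
    cx_rep (cx_gen i) *m v = reflection cx_gram (tnth cx_simple i) v
}.

Section Descent.
Variables (R : realType) (n : nat) (W : finGroupType).
Variable (C : coxeter_data R n W).
Local Notation alpha := (tnth (cx_simple C)).

(* Subsets of the set of simple roots are represented by their sets of indices,
   of type {set 'I_n}; alpha is injective. *)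
Implicit Types (i j : 'I_n) (J K L : {set 'I_n}) (w : W).

Definition cx_act w (v : 'cV[R]_n) : 'cV[R]_n := cx_rep C w *m v.

Definition negative_root (v : 'cV[R]_n) : bool :=
  (v \in cx_root C) && nonneg_comb (cx_simple C) (- v).

Definition descent w : {set 'I_n} :=
  [set i | negative_root (cx_act w (alpha i))].

Definition X_set J : {set W} := [set w | descent w :&: J == set0].

(* w(K) \subseteq Pi *)
Definition maps_simple w K : bool :=
  [forall i in K, exists j, cx_act w (alpha i) == alpha j].

(* w(K) = L *)
Definition maps_onto w K L : bool :=
  [forall i in K, exists j in L, cx_act w (alpha i) == alpha j] &&
  [forall j in L, exists i in K, cx_act w (alpha i) == alpha j].

Definition equivalent : rel {set 'I_n} :=
  fun K L => [exists w, maps_onto w K L].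

Definition eqclass K : {set {set 'I_n}} := [set L | equivalent K L].

Definition eqclasses : {set {set {set 'I_n}}} :=
  equivalence_partition equivalent [set: {set 'I_n}].

(* The common cardinality of the members of a class. *)
Definition class_norm (lambda : {set {set 'I_n}}) : nat :=
  if [pick K in lambda] is Some K then #|K| else 0%N.

(* The group algebra, as the space of functions W -> R. *)
Local Notation group_algebra := {ffun W -> R^o}.

Definition group_elt w : group_algebra := [ffun g => (g == w)%:R].

Definition x_elt J : group_algebra := \sum_(w in X_set J) group_elt w.

(* mu K J and beta K J stand for mu_K^J and beta_K^J. *)
Definition mu K J : R :=
  if K \subset J then
    #|[set w in X_set J | maps_simple w K]|%:R / #|eqclass K|%:R
  else 0.

Definition mu_mx : 'M[R]_#|{: {set 'I_n}}| :=
  \matrix_(a, b) mu (enum_val a) (enum_val b).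

Definition beta K J : R := invmx mu_mx (enum_rank K) (enum_rank J).

Definition e_elt J : group_algebra :=
  \sum_(K : {set 'I_n} | K \subset J) beta K J *: x_elt K.

Definition e_class (lambda : {set {set 'I_n}}) : group_algebra :=
  \sum_(J in lambda) #|lambda|%:R^-1 *: e_elt J.

Definition M_elt (x : R) : group_algebra :=
  \sum_(lambda in eqclasses) x ^- class_norm lambda *: e_class lambda.

(* p as a polynomial function on V satisfies p (w v) = p v. *)
Definition is_invariant (p : {mpoly R[n]}) : Prop :=
  forall w, p \mPo [tuple \sum_(j < n) cx_rep C w i j *: 'X_j | i < n] = p.

Definition basic_invariants (f : n.-tuple {mpoly R[n]}) : Prop :=
  [/\ forall i, is_invariant (tnth f i),
      forall p, is_invariant p -> exists g : {mpoly R[n]}, p = g \mPo f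
    & forall g : {mpoly R[n]}, g \mPo f = 0 -> g = 0].

Definition are_exponents (m : 'I_n -> nat) : Prop :=
  exists2 f : n.-tuple {mpoly R[n]},
    basic_invariants f & forall i, tnth f i \is (m i).+1.-homog.

End Descent.

(* Main.v *)
Require Import Defs.
From HB Require Import structures.
From mathcomp Require Import all_boot all_order all_algebra all_fingroup.
From mathcomp Require Import all_character.
From mathcomp Require Import reals.
From mathcomp Require Import mpoly.
From mathcomp Require Import ring zify.
Set Implicit Arguments.
Unset Strict Implicit.
Unset Printing Implicit Defensive.
Import Order.TTheory GRing.Theory Num.Theory.
Local Open Scope ring_scope.

(* Two facts are combined.

   (1) The coefficient of the identity in [M_elt] is
   |W|^-1 * \sum_w x^-(codim Fix w).  Every x_K has identity coefficient 1, so
   the coefficients c_K of the e_K are the unique solution of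
   \sum_(K \subset J) mu_K^J c_K = 1, and a solution is guessed as follows.
   Give each w in W_J total weight 1, spread evenly over the faces u C_L of the
   Coxeter complex that span Fix w, and move each face by W_J into the
   J-dominant cone: the faces of that cone spanning K^perp are counted by the
   numerator of mu_K^J, and the elements fixing exactly K^perp lie in W_K.

   (2) Solomon's formula \sum_w x^(dim Fix w) = \prod_i (x + m_i), for any
   finite group of real matrices whose invariants are generated by n
   homogeneous polynomials f_i of degrees m_i + 1.  For 0 < t < 1 and generic c
   let z_w be the solution of w^-1 z = t z + c.  With F = Df and J = det F,
   invariance gives det (F(z) + y F(t z + c)) = J(z) det (1 + y w) at z = z_w,
   so the Euler-Jacobi relation
   \sum_w q(z_w) / (J(z_w) det (1 - t w)) = 0 for deg q < deg J
   yields \sum_w det (1 + y w) / det (1 - t w)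
     = |W| \prod_i (1 + y t^m_i) / (1 - t^(m_i + 1)),
   and y = x (1 - t) - 1, t -> 1 gives the formula.  The Euler-Jacobi relation
   is Lagrange interpolation along a line c = c0 + a c1: on it J(z_w) has simple
   real zeros, each at a point fixed by one reflection s, where the residues of
   w and s w cancel. *)

(** * Linear algebra and univariate polynomials *)

(** The equation w^-1 z = t z + c is chosen because its solutions satisfy f(z) = f(t z + c): the z_w
    solve this polynomial system, and J(z_w) det (1 - t w) is its Jacobian determinant there. The
    Euler-Jacobi relation is thus the classical vanishing of a total residue. Degree deg J is just
    too large for it, so it is applied to a combination of the determinants for y and for -t whose
    top-degree terms cancel; at y = -t every summand is 1, which produces |W|. Real-rootedness of J
    along lines comes from generation alone: J divides a product of differences of linear forms
    taken in one orbit, for any basis of forms, and the basis can be adapted to the point so that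
    this product does not vanish there, or has only a simple zero. In (1) the obstacle is that
    mu_K^J counts elements x of X_J with x(K) in Pi, while a sum over W_J sees only fixed spaces.
    The link is the bijection from such x to the faces x^-1 C_{x(K)}, which are the faces spanning
    K^perp in the J-dominant cone. *)

Lemma det_1D_mulmxC (F : comNzRingType) (m k : nat) (A : 'M[F]_(m, k))
    (B : 'M[F]_(k, m)) :
  \det (1%:M + A *m B) = \det (1%:M + B *m A).
Proof.
have e1 : block_mx 1%:M (- A) B 1%:M =
    block_mx 1%:M 0 B 1%:M *m block_mx 1%:M (- A) 0 (1%:M + B *m A).
  rewrite mulmx_block ?mul1mx ?mul0mx ?mulmx1 ?mulmx0 ?addr0 ?mulmxN.
  by congr block_mx; rewrite addrCA addNr addr0.
have e2 : block_mx 1%:M (- A) B 1%:M =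
    block_mx 1%:M (- A) 0 1%:M *m block_mx (1%:M + A *m B) 0 B 1%:M.
  rewrite mulmx_block ?mul1mx ?mul0mx ?mulmx1 ?mulmx0 ?addr0 ?add0r ?mulNmx.
  by congr block_mx; rewrite addrK.
have := congr1 determinant e1; rewrite e2 !det_mulmx !det_ublock !det_lblock.
by rewrite !det1 !mul1r !mulr1.
Qed.

Section RealField.
Variable R : realFieldType.

Lemma poly_nonroot (p : {poly R}) (a : nat -> R) :
  injective a -> p != 0 -> exists k, p.[a k] != 0.
Proof.
move=> ia p0; have [/hasP[k _ pk]|] :=
    boolP (has (fun k => p.[a k] != 0) (iota 0 (size p))); first by exists k.
rewrite -all_predC => /allP h.
have /(max_poly_roots p0)/(_ _) : all (root p) (map a (iota 0 (size p))).
  by apply/allP=> _ /mapP[k /h /negPn pk ->].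
by rewrite map_inj_uniq ?iota_uniq // size_map size_iota ltnn => /(_ isT).
Qed.

Lemma poly_eq_interval (p q : {poly R}) :
  (forall t, 0 < t < 1 -> p.[t] = q.[t]) -> p = q.
Proof.
move=> h; apply/eqP; rewrite -subr_eq0; apply/negPn/negP=> pq0.
have [|k] := poly_nonroot (a := fun k => (k.+2)%:R^-1) _ pq0.
  by move=> i j /invr_inj/eqP; rewrite eqr_nat => /eqP[].
rewrite hornerD hornerN h ?subrr ?eqxx //.
by rewrite invr_gt0 ltr0n /= invf_lt1 ?ltr0n // ltr1n.
Qed.

Lemma poly_eq_nat (p q : {poly R}) :
  (forall k : nat, p.[k%:R] = q.[k%:R]) -> p = q.
Proof.
move=> h; apply/eqP; rewrite -subr_eq0; apply/negPn/negP=> pq0.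
have [|k] := poly_nonroot (a := fun k => k%:R) _ pq0.
  by move=> i j /eqP; rewrite eqr_nat => /eqP.
by rewrite hornerD hornerN h ?subrr ?eqxx.
Qed.

Lemma avoid_scalars (s : seq R) : exists k, k \notin s.
Proof.
have p0 : \prod_(a <- s) ('X - a%:P) != 0.
  by rewrite monic_neq0 ?monic_prod_XsubC.
have [|k] := poly_nonroot (a := fun k => k%:R) _ p0.
  by move=> i j /eqP; rewrite eqr_nat => /eqP.
by rewrite -rootE root_prod_XsubC; exists k%:R.
Qed.

(** Induction on the list: a vector good for [s] is moved along a coordinate direction [u] not
    killed by [a], and each form excludes at most one value of the parameter. *)
Lemma avoid_forms n (s : seq 'rV[R]_n) :
  {in s, forall a, a != 0} -> exists v : 'cV_n, {in s, forall a, a *m v != 0}.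
Proof.
elim: s => [|a s IH] sn0; first by exists 0.
have [|v hv] := IH; first by move=> b bs; rewrite sn0 // inE bs orbT.
have [j aj] : exists j, a 0 j != 0.
  by apply/rV0Pn; rewrite sn0 ?mem_head.
pose u : 'cV[R]_n := delta_mx j 0.
have au : (a *m u) 0 0 != 0 by rewrite -colE mxE.
have [t ht] := avoid_scalars
  [seq - ((b : 'rV_n) *m v) 0 0 / (b *m u) 0 0 | b <- a :: s].
exists (v + t *: u) => b bs; apply/negP=> /eqP.
rewrite mulmxDr -scalemxAr => /matrixP/(_ 0 0).
rewrite mxE [X in _ + X]mxE [RHS]mxE => e.
have [bu|bu] := eqVneq ((b *m u) 0 0) 0.
  move: bs; rewrite inE => /orP[/eqP eb|/hv]; first by rewrite -eb bu eqxx in au.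
  move: e; rewrite bu mulr0 addr0 => e.
  by rewrite [b *m v]mx11_scalar e raddf0 eqxx.
case/negP: ht; apply/mapP; exists b => //.
by apply/(canRL (mulfK bu)); move/eqP: e; rewrite addrC addr_eq0 => /eqP.
Qed.

End RealField.

Section RealField2.
Variable R : realFieldType.

(** For a full-rank factorization E = C R, the equation E E = E reads C (R C) R = C R, and C and R
    can be cancelled. Trace and determinant of an idempotent then reduce to its rank. *)
Lemma col_row_base_idem n (E : 'M[R]_n) :
  E *m E = E -> row_base E *m col_base E = 1%:M.
Proof.
move=> EE; apply: (row_free_inj (row_base_free E)).
rewrite mul1mx; apply: (row_full_inj (A := col_base E)).
  exact: col_base_full.
by rewrite -[X in _ *m X]mulmxA mulmx_base [LHS](mulmxA (col_base E)) mulmx_base EE.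
Qed.

Lemma det_1D_idem n (E : 'M[R]_n) (y : R) :
  E *m E = E -> \det (1%:M + y *: E) = (1 + y) ^+ \rank E.
Proof.
move=> EE; rewrite -{1}(mulmx_base E) scalemxAl det_1D_mulmxC.
by rewrite -scalemxAr col_row_base_idem // scalemx1 -raddfD det_scalar.
Qed.

Lemma tr_idem n (E : 'M[R]_n) : E *m E = E -> \tr E = (\rank E)%:R.
Proof.
move=> EE; rewrite -{1}(mulmx_base E) mxtrace_mulC col_row_base_idem //.
by rewrite mxtrace1.
Qed.

(** Lagrange interpolation of [q] at the simple roots of [j], divided by [j]. Here [ja a] is j / (X
    - a), whose value at [a] is j'(a); the size bound says deg q < deg j. *)
Lemma lagrange_residues (q j : {poly R}) (r : seq R) (c x : R) :
    c != 0 -> uniq r -> j = c *: \prod_(a <- r) ('X - a%:P) ->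
    (size q <= size r)%N -> x \notin r ->
  q.[x] / j.[x] = \sum_(a <- r) q.[a] / (j^`().[a] * (x - a)).
Proof.
move=> c0 ur jE qr xr.
pose ja a : {poly R} := c *: \prod_(b <- rem a r) ('X - b%:P).
have jE' a : a \in r -> j = ('X - a%:P) * ja a.
  move=> ar; rewrite jE (perm_big _ (perm_to_rem ar)) big_cons.
  by rewrite scalerAr.
have jaE a : a \in r -> j^`().[a] = (ja a).[a].
  move=> ar; rewrite (jE' a ar) derivM derivXsubC mul1r !hornerE.
  by rewrite subrr mul0r addr0.
have jaN0 a : a \in r -> (ja a).[a] != 0.
  move=> ar; rewrite hornerZ mulf_neq0 // -rootE root_prod_XsubC.
  by rewrite mem_rem_uniq // !inE eqxx.
have ja0 a b : a \in r -> b \in r -> b != a -> (ja a).[b] = 0.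
  move=> ar br ba; apply/eqP; rewrite hornerZ mulf_eq0 (negPf c0) /=.
  by rewrite -rootE root_prod_XsubC mem_rem_uniq // !inE ba.
pose p : {poly R} := \sum_(a <- r) (q.[a] / (ja a).[a]) *: ja a.
have qp : q = p.
  apply/eqP; rewrite -subr_eq0; apply/negPn/negP => d0.
  have sz : (size (q - p)%R <= size r)%N.
    rewrite (leq_trans (size_polyD _ _)) // size_polyN geq_max qr /=.
    rewrite /p big_seq; apply: (big_ind (fun p : {poly R} => (size p <= size r)%N)).
    - by rewrite size_poly0.
    - by move=> u v hu hv; rewrite (leq_trans (size_polyD _ _)) // geq_max hu.
    - move=> a ar; rewrite !(leq_trans (size_scale_leq _ _)) //.
      by rewrite size_prod_XsubC size_rem // prednK // -has_predT; apply/hasP; exists a.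
  have /(max_poly_roots d0)/(_ ur) : all (root (q - p)) r.
    apply/allP => a ar; rewrite rootE hornerD hornerN subr_eq0 /p horner_sum.
    rewrite (perm_big _ (perm_to_rem ar)) big_cons hornerZ divfK ?jaN0 //.
    rewrite big_seq big1 /= ?addr0 // => b; rewrite mem_rem_uniq // !inE.
    by case/andP=> ba br; rewrite hornerZ (ja0 b a) ?mulr0 // eq_sym.
  by rewrite ltnNge sz.
rewrite {1}qp /p horner_sum mulr_suml big_seq [RHS]big_seq.
apply: eq_bigr => a ar; rewrite (jE' a ar) hornerM hornerZ -jE' // jaE //.
have xa : x - a != 0 by rewrite subr_eq0; apply: contraNneq xr => ->.
have jx : (ja a).[x] != 0.
  rewrite hornerZ mulf_neq0 // -rootE root_prod_XsubC.
  by apply: contra xr => /mem_rem.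
by rewrite hornerXsubC; field; rewrite jaN0 // xa.
Qed.

(* The degree bounds are formal: leading coefficients may vanish. *)
Lemma prod_poly_coef (I : Type) (m : I -> nat) (s : seq I) (p : I -> {poly R}) :
    (forall i, size (p i) <= (m i).+1)%N ->
  (size (\prod_(i <- s) p i)%R <= (\sum_(i <- s) m i).+1)%N /\
  (\prod_(i <- s) p i)`_(\sum_(i <- s) m i) = \prod_(i <- s) (p i)`_(m i).
Proof.
move=> sp; elim: s => [|i s [IH1 IH2]].
  by rewrite !big_nil size_poly1 coef1.
rewrite !big_cons; split.
  rewrite (leq_trans (size_polyMleq _ _)) // -addnS.
  by rewrite -[leqRHS]/((m i).+1 + _).-1 -!subn1 leq_sub2r // leq_add.
rewrite -IH2 coefM.
have lt : (m i < (m i + \sum_(j <- s) m j).+1)%N by rewrite ltnS leq_addr.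
rewrite (bigD1 (Ordinal lt)) //= addKn [X in _ + X]big1 ?addr0 // => k kn.
have [km|km] := ltnP (m i) k.
  by rewrite [(p i)`_k]nth_default ?mul0r // (leq_trans (sp i)).
rewrite [X in _ * X]nth_default ?mulr0 //.
rewrite (leq_trans IH1) // ltn_subRL.
have : (k < m i)%N by rewrite ltn_neqAle km andbT.
by rewrite -(ltn_add2r (\sum_(j <- s) m j)).
Qed.

(** Each term of the Leibniz formula takes one entry from every row, so the row bounds [m i] give
    all terms the same formal degree. *)
Lemma det_poly_coef n (m : 'I_n -> nat) (M : 'M[{poly R}]_n) :
    (forall i j, size (M i j) <= (m i).+1)%N ->
  let D := (\sum_i m i)%N in
  (size (\det M) <= D.+1)%N /\ (\det M)`_D = \det (\matrix_(i, j) (M i j)`_(m i)).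
Proof.
move=> sM D.
have hdet (s : 'S_n) : (size (\prod_i M i (s i : 'I_n))%R <= D.+1)%N /\
   (\prod_i M i (s i : 'I_n))`_D = \prod_i (M i (s i))`_(m i).
  by apply: prod_poly_coef => i; apply: sM.
split.
  apply: (big_ind (fun p : {poly R} => (size p <= D.+1)%N)).
  - by rewrite size_poly0.
  - by move=> u v hu hv; rewrite (leq_trans (size_polyD _ _)) // geq_max hu.
  - move=> s _; rewrite -signr_odd; case: odd; rewrite ?expr1 ?expr0 ?mulN1r ?mul1r ?size_polyN.
      by have [] := hdet s.
    by have [] := hdet s.
rewrite /determinant coef_sum; apply: eq_bigr => s _.
have -> : (-1) ^+ s = ((-1) ^+ s)%:P :> {poly R} by rewrite rmorphXn /= rmorphN1.
rewrite coefCM; congr (_ * _); rewrite (hdet s).2.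
by apply: eq_bigr => i _; rewrite mxE.
Qed.
End RealField2.

(** * Polynomials in several variables, restricted to lines *)

Lemma mderivXU (R : nzRingType) n (i j : 'I_n) :
  ('X_i : {mpoly R[n]})^`M(j) = (i == j)%:R.
Proof.
rewrite mderivX mnm1E; case: eqP => [->|_]; last by rewrite scale0r.
by rewrite -{1}[U_(j)%MM]add0m addmK mpolyX0 scale1r.
Qed.

Section Mpoly.
Variables (R : realFieldType) (n : nat).
Implicit Types (p q : {mpoly R[n]}) (z u v : 'cV[R]_n).

Lemma mpoly_ring_ind (P : {mpoly R[n]} -> Prop) :
    (forall c, P c%:MP) -> (forall i, P 'X_i) ->
    (forall p q, P p -> P q -> P (p + q)) ->
    (forall p q, P p -> P q -> P (p * q)) ->
  forall p, P p.
Proof.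
move=> PC PX PD PM; apply: mpolyind => [|c m p _ _ Pp]; first exact: (PC 0).
apply: (PD) => //; rewrite -mul_mpolyC mpolyXE_id; apply: (PM) => //.
apply: big_ind => [||i _]; [exact: (PC 1) | exact: (PM) |].
by elim: (m i) => [|k IH]; rewrite ?exprS; [exact: (PC 1) | exact: PM].
Qed.

Definition ev z p : R := p.@[fun i => z i 0].

(** The restriction of [p] to the line a |-> z + a u, as a polynomial in a; it brings univariate
    root counting to bear on [p]. *)
Definition line z u p : {poly R} :=
  mmap (@polyC R) (fun i => (z i 0)%:P + (u i 0) *: 'X) p.

HB.instance Definition _ z u := GRing.RMorphism.copy (line z u)
  (mmap (@polyC R) (fun i => (z i 0)%:P + (u i 0) *: 'X)).

Lemma lineC z u c : line z u c%:MP = c%:P.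
Proof. exact: mmapC. Qed.

Lemma lineD z u : {morph line z u : p q / p + q}.
Proof. exact: mmapD. Qed.

Lemma lineM z u : {morph line z u : p q / p * q}.
Proof. exact: rmorphM. Qed.

Lemma lineX z u i : line z u 'X_i = (z i 0)%:P + (u i 0) *: 'X.
Proof. by rewrite /line mmapX mmap1U. Qed.

Lemma line_horner z u p t : (line z u p).[t] = ev (z + t *: u) p.
Proof.
elim/mpoly_ring_ind: p => [c|i|p q IHp IHq|p q IHp IHq].
- by rewrite lineC hornerC /ev mevalC.
- by rewrite lineX !hornerE /ev mevalXU !mxE mulrC.
- by rewrite lineD hornerD /ev mevalD IHp IHq.
- by rewrite lineM hornerM /ev mevalM IHp IHq.
Qed.

Lemma line_deriv z u p : (line z u p)^`() = \sum_j (u j 0) *: line z u p^`M(j).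
Proof.
elim/mpoly_ring_ind: p => [c|i|p q IHp IHq|p q IHp IHq].
- rewrite lineC derivC big1 // => j _.
  by rewrite mderivC (lineC _ _ 0) polyC0 scaler0.
- rewrite lineX derivD derivC add0r derivZ derivX (bigD1 i) //= big1 ?addr0.
    by rewrite mderivXU eqxx /line rmorph1.
  move=> j ji; rewrite mderivXU eq_sym (negPf ji).
  by rewrite (lineC _ _ 0) polyC0 scaler0.
- rewrite lineD derivD IHp IHq -big_split; apply: eq_bigr => j _ /=.
  by rewrite mderivD lineD scalerDr.
- rewrite lineM derivM IHp IHq mulr_suml mulr_sumr -big_split.
  apply: eq_bigr => j _ /=.
  by rewrite mderivM lineD !lineM scalerDr scalerAl scalerAr.
Qed.

Lemma line_homog d z u p : p \is d.-homog ->
  (size (line z u p) <= d.+1)%N /\ (line z u p)`_d = ev u p.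
Proof.
move=> /dhomogP hp; rewrite /line /mmap /ev mevalE.
have mono m : mdeg m = d ->
    let q := mmap1 (fun i => (z i 0)%:P + u i 0 *: 'X) m in
    (size q <= d.+1)%N /\ q`_d = \prod_i u i 0 ^+ m i.
  move=> md q; rewrite -md mdegE /q /mmap1.
  have pw k a b : (size ((a%:P + b *: 'X : {poly R}) ^+ k)%R <= k.+1)%N /\
      ((a%:P + b *: 'X : {poly R}) ^+ k)`_k = b ^+ k.
    have s1 (i : 'I_k) : (size (a%:P + b *: 'X : {poly R})%R <= 2)%N.
      rewrite (leq_trans (size_polyD _ _)) // geq_max size_polyC.
      by rewrite (leq_trans (size_scale_leq _ _)) ?size_polyX // andbT; case: eqP.
    have := prod_poly_coef (index_enum 'I_k) s1.
    rewrite !prodr_const sum_nat_const card_ord muln1 coefD coefC /= coefZ.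
    by rewrite coefX mulr1 add0r.
  have [|h1 h2] := @prod_poly_coef R 'I_n m (index_enum 'I_n)
    (fun i => ((z i 0)%:P + (u i 0) *: 'X) ^+ m i).
    by move=> i; have [] := pw (m i) (z i 0) (u i 0).
  by split=> //; rewrite h2; apply: eq_bigr => i _; have [] := pw (m i) (z i 0) (u i 0).
split.
  rewrite big_seq.
  apply: (big_ind (fun p : {poly R} => (size p <= d.+1)%N)).
  - by rewrite size_poly0.
  - by move=> a b ha hb; rewrite (leq_trans (size_polyD _ _)) // geq_max ha.
  - move=> m mp; rewrite mul_polyC (leq_trans (size_scale_leq _ _)) //.
    by have [] := mono m (hp m mp).
rewrite coef_sum big_seq [RHS]big_seq; apply: eq_bigr => m mp.
by rewrite coefCM (mono m (hp m mp)).2.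
Qed.

End Mpoly.

Lemma mderiv_comp (R : realFieldType) n k (g : {mpoly R[k]})
    (f : k.-tuple {mpoly R[n]}) j :
  (g \mPo f)^`M(j) = \sum_i (g^`M(i) \mPo f) * (tnth f i)^`M(j).
Proof.
elim/mpoly_ring_ind: g => [c|i|p q IHp IHq|p q IHp IHq].
- rewrite comp_mpolyC mderivC big1 // => i _.
  by rewrite mderivC comp_mpoly0 mul0r.
- rewrite (bigD1 i) //= big1 ?addr0.
    rewrite mderivXU eqxx comp_mpoly1 mul1r.
    by rewrite comp_mpolyXU -tnth_nth.
  move=> l li; rewrite mderivXU eq_sym (negPf li).
  by rewrite comp_mpoly0 mul0r.
- rewrite comp_mpolyD mderivD IHp IHq -big_split; apply: eq_bigr => i _ /=.
  by rewrite mderivD comp_mpolyD mulrDl.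
- rewrite rmorphM mderivM IHp IHq mulr_suml mulr_sumr -big_split.
  apply: eq_bigr => i _ /=.
  by rewrite mderivM comp_mpolyD !rmorphM /=; ring.
Qed.

(** * The Jacobian of the basic invariants *)

Section Rep.
Variables (R : realFieldType) (n : nat) (W : finGroupType).
Variable rW : mx_representation R [set: W]%G n.
Implicit Types (g h w : W).

Lemma rep1 : rW 1%g = 1%:M. Proof. exact: repr_mx1. Qed.
Lemma repM g h : rW (g * h)%g = rW g *m rW h.
Proof. by rewrite repr_mxM ?inE. Qed.
Lemma repVK g : rW g^-1%g *m rW g = 1%:M.
Proof. by rewrite -repM mulVg rep1. Qed.
Lemma repKV g : rW g *m rW g^-1%g = 1%:M.
Proof. by rewrite -repM mulgV rep1. Qed.
Lemma rep_unit g : rW g \in unitmx.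
Proof. by case/mulmx1_unit: (repKV g). Qed.

(** The average over the cyclic group of [w], which is the projection onto Fix w commuting with [w];
    its rank is dim Fix w. *)
Definition fixproj w : 'M[R]_n := #[w]%g%:R^-1 *: \sum_(i < #[w]%g) rW (w ^+ i)%g.

Lemma fixproj_fix w k (v : 'M_(n, k)) : rW w *m v = v -> fixproj w *m v = v.
Proof.
move=> wv; rewrite -scalemxAl mulmx_suml.
rewrite (eq_bigr (fun=> v)) => [|i _].
  rewrite sumr_const card_ord.
  by rewrite -scaler_nat scalerA mulVf ?scale1r // pnatr_eq0 -lt0n order_gt0.
elim: (i : nat) => [|l IH]; first by rewrite expg0 rep1 mul1mx.
by rewrite expgSr repM -mulmxA wv.
Qed.

Lemma rep_fixproj w : rW w *m fixproj w = fixproj w.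
Proof.
rewrite -scalemxAr; congr (_ *: _); rewrite mulmx_sumr.
have [k ek] : exists k, #[w]%g = k.+1 by exists #[w]%g.-1; rewrite prednK ?order_gt0.
have wk : (w ^+ k.+1)%g = 1%g by rewrite -ek expg_order.
rewrite ek big_ord_recr [RHS]big_ord_recl /= addrC; congr (_ + _).
  by rewrite -repM -expgS wk.
by apply: eq_bigr => i _; rewrite -repM -expgS.
Qed.

Lemma fixproj_rep w : fixproj w *m rW w = fixproj w.
Proof.
rewrite -[RHS]rep_fixproj -scalemxAl -scalemxAr mulmx_suml mulmx_sumr.
by congr (_ *: _); apply: eq_bigr => i _; rewrite -!repM -expgS -expgSr.
Qed.

Lemma fixproj_idem w : fixproj w *m fixproj w = fixproj w.
Proof. exact/fixproj_fix/rep_fixproj. Qed.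

Lemma rank_fixproj w : \rank (fixproj w) = (n - \rank (rW w - 1%:M)%R)%N.
Proof.
have EE := fixproj_idem w.
have idC : (1%:M - fixproj w) *m (1%:M - fixproj w) = 1%:M - fixproj w.
  by rewrite mulmxBr mulmx1 mulmxBl mul1mx EE subrr subr0.
(* By telescoping, each 1 - w^i is divisible by 1 - w, so the rank of 1 - E is at most that of w -
   1. *)
have f : 1%:M - fixproj w = (#[w]%g%:R^-1 *: \sum_(i < #[w]%g) \sum_(k < i) rW (w ^+ k)%g)
   *m (1%:M - rW w).
  rewrite -scalemxAl mulmx_suml.
  have -> : 1%:M - fixproj w =
      #[w]%g%:R^-1 *: \sum_(i < #[w]%g) (1%:M - rW (w ^+ i)%g).
    rewrite sumrB scalerBr sumr_const card_ord; congr (_ - _).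
    rewrite -scaler_nat scalerA mulVf ?scale1r //.
    by rewrite pnatr_eq0 -lt0n order_gt0.
  congr (_ *: _); apply: eq_bigr => i _.
  elim: (i : nat) => [|l IH]; first by rewrite big_ord0 mul0mx expg0 rep1 subrr.
  rewrite big_ord_recr /= mulmxDl -IH mulmxBr mulmx1 -repM -expgSr.
  by rewrite addrA subrK.
have r1 : (\rank (1%:M - fixproj w)%R <= \rank (rW w - 1%:M)%R)%N.
  by rewrite f (leq_trans (mxrankM_maxr _ _)) // -mxrank_opp opprB.
have r2 : (\rank (rW w - 1%:M)%R <= \rank (1%:M - fixproj w)%R)%N.
  suff -> : rW w - 1%:M = (rW w - 1%:M) *m (1%:M - fixproj w).
    exact: mxrankM_maxr.
  by rewrite mulmxBr mulmx1 [_ *m fixproj w]mulmxBl rep_fixproj mul1mx subrr subr0.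
have -> : \rank (rW w - 1%:M) = \rank (1%:M - fixproj w).
  by apply/eqP; rewrite eqn_leq r1 r2.
apply/(@addIn (\rank (1%:M - fixproj w)))/eqP; rewrite subnK ?rank_leq_row //.
rewrite -(eqr_nat R) natrD -!tr_idem // raddfB /= mxtrace1.
by rewrite addrC subrK.
Qed.

(** Write w = E + M with E the projection onto Fix w and E M = 0; then 1 + y w = (1 + y E)(1 + y M).
    This isolates the order of vanishing at y = -1, where the second factor is nonzero. *)
Lemma det_rep w (y : R) :
  \det (1%:M + y *: rW w) =
  (1 + y) ^+ \rank (fixproj w) * \det (1%:M + y *: (rW w *m (1%:M - fixproj w))).
Proof.
rewrite -det_1D_idem ?fixproj_idem // -det_mulmx; congr (\det _).
have EM : fixproj w *m (rW w *m (1%:M - fixproj w)) = 0.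
  by rewrite mulmxA fixproj_rep mulmxBr mulmx1 fixproj_idem subrr.
have Mw : rW w = rW w *m (1%:M - fixproj w) + fixproj w.
  by rewrite mulmxBr mulmx1 rep_fixproj subrK.
rewrite {1}Mw; move: EM; set M := rW w *m _ => EM.
rewrite mulmxDl mul1mx mulmxDr mulmx1 -[_ *m (y *: M)]scalemxAl -scalemxAr EM.
by rewrite !scaler0 addr0 scalerDr addrA.
Qed.

(** A row vector in the kernel is killed by E, hence is fixed by w, hence equals its own image under
    E, which is 0. *)
Lemma det_fixproj_neq0 w :
  \det (1%:M - rW w *m (1%:M - fixproj w)) != 0.
Proof.
rewrite -unitfE -[_ \is a _]unitmxE -row_free_unit -kermx_eq0; apply/eqP.
have := mulmx_ker (1%:M - rW w *m (1%:M - fixproj w)); move: (kermx _) => K.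
rewrite mulmxBr mulmx1 => /eqP; rewrite subr_eq0 => /eqP K1.
have KE : K *m fixproj w = 0.
  by rewrite K1 -!mulmxA mulmxBl mul1mx fixproj_idem subrr !mulmx0.
move: K1; rewrite mulmxBr mulmx1 mulmxBr rep_fixproj KE subr0 => K1.
have : K *m fixproj w = K.
  rewrite -scalemxAr mulmx_sumr (eq_bigr (fun=> K)) => [|i _].
    rewrite sumr_const card_ord -scaler_nat scalerA mulVf ?scale1r //.
    by rewrite pnatr_eq0 -lt0n order_gt0.
  elim: (i : nat) => [|l IH]; first by rewrite expg0 rep1 mulmx1.
  by rewrite expgSr repM mulmxA IH -K1.
by rewrite KE => <-.
Qed.

(** If K = t K w, iterating up to the order of w gives K = t^order K, with t^order < 1. *)
Lemma det_1Bt_neq0 w t : 0 < t < 1 -> \det (1%:M - t *: rW w) != 0.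
Proof.
case/andP=> t0 t1; rewrite -unitfE -[_ \is a _]unitmxE -row_free_unit.
rewrite -kermx_eq0; apply/eqP; have := mulmx_ker (1%:M - t *: rW w); move: (kermx _) => K.
rewrite mulmxBr mulmx1 -scalemxAr => /eqP; rewrite subr_eq0 => /eqP K1.
have Kk k : K = t ^+ k *: (K *m rW (w ^+ k)%g).
  elim: k => [|k IH]; first by rewrite expr0 expg0 rep1 mulmx1 scale1r.
  by rewrite expgS repM mulmxA exprSr -scalerA scalemxAl -K1.
have /eqP := Kk #[w]%g; rewrite expg_order rep1 mulmx1.
rewrite -subr_eq0 -{1}[K]scale1r -scalerBl scaler_eq0 subr_eq0 eq_sym.
have t1' : t ^+ #[w]%g < 1 by rewrite exprn_ilt1 ?ltW // -lt0n order_gt0.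
by rewrite (lt_eqF t1') => /eqP.
Qed.
End Rep.

(** * The Jacobian divides products of linear forms *)

Section Jacobian.
Variables (R : realFieldType) (n : nat) (W : finGroupType).
Variable rW : mx_representation R [set: W]%G n.
Implicit Types (g h w : W) (l mu : 'rV[R]_n) (z u : 'cV[R]_n).

Definition act_tuple w : n.-tuple {mpoly R[n]} :=
  [tuple \sum_(j < n) rW w i j *: 'X_j | i < n].

Definition rep_invariant (p : {mpoly R[n]}) : Prop :=
  forall w, p \mPo act_tuple w = p.

Lemma ev_act w z p : ev z (p \mPo act_tuple w) = ev (rW w *m z) p.
Proof.
rewrite /ev comp_mpoly_meval; apply: meval_eq => i.
rewrite tnth_mktuple mxE raddf_sum /=; apply: eq_bigr => j _.
by rewrite mevalZ mevalXU.
Qed.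

Definition lin l : {mpoly R[n]} := \sum_j l 0 j *: 'X_j.

Lemma lin_act l w : lin l \mPo act_tuple w = lin (l *m rW w).
Proof.
rewrite /lin raddf_sum /=; under eq_bigr => i _.
  rewrite comp_mpolyZ comp_mpolyXU -tnth_nth tnth_mktuple scaler_sumr.
  under eq_bigr => j _ do rewrite scalerA. over.
rewrite exchange_big /=; apply: eq_bigr => j _.
by rewrite -scaler_suml mxE.
Qed.

Lemma mderiv_lin l j : (lin l)^`M(j) = (l 0 j)%:MP.
Proof.
rewrite /lin raddf_sum /= (bigD1 j) //= big1 ?addr0.
  by rewrite mderivZ mderivXU eqxx -mul_mpolyC mulr1.
by move=> i ij; rewrite mderivZ mderivXU (negPf ij) scaler0.
Qed.

Lemma line_lin l z u : line z u (lin l) = ((l *m z) 0 0)%:P + (l *m u) 0 0 *: 'X.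
Proof.
rewrite /lin raddf_sum /= !mxE raddf_sum scaler_suml -big_split.
apply: eq_bigr => j _ /=.
rewrite -mul_mpolyC lineM lineC lineX mulrDr -polyCM; congr (_ + _).
by rewrite -scalerA mul_polyC.
Qed.

Lemma lin_inj_sub l mu : lin l - lin mu = lin (l - mu).
Proof. by rewrite /lin -sumrB; apply: eq_bigr => j _; rewrite !mxE scalerBl. Qed.

(** Repetitions are removed so that deleting [l] once leaves only forms different from [l];
    otherwise [orbit_diff l] could be 0. *)
Definition orbl l : seq 'rV[R]_n := undup [seq l *m rW g | g <- enum [set: W]].

Lemma orblP l mu : reflect (exists g, mu = l *m rW g) (mu \in orbl l).
Proof.
rewrite mem_undup; apply: (iffP mapP) => [[g _ ->]|[g ->]]; first by exists g.
by exists g; rewrite // mem_enum inE.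
Qed.

Lemma orbl_refl l : l \in orbl l.
Proof. by apply/orblP; exists 1%g; rewrite rep1 mulmx1. Qed.

Lemma perm_orbl l w : perm_eq [seq mu *m rW w | mu <- orbl l] (orbl l).
Proof.
apply: uniq_perm; rewrite ?undup_uniq //.
  rewrite map_inj_uniq ?undup_uniq // => a b /(congr1 (mulmx^~ (rW w^-1%g))).
  by rewrite -!mulmxA repKV !mulmx1.
move=> mu; apply/mapP/orblP => [[_ /orblP[g ->] ->]|[g ->]].
  by exists (g * w)%g; rewrite repM mulmxA.
exists (l *m rW (g * w^-1)%g); first by apply/orblP; exists (g * w^-1)%g.
by rewrite -mulmxA -repM mulgKV.
Qed.

(** Its coefficients are, up to sign, the elementary symmetric functions of the orbit. They are the
    invariants to which the generation hypothesis is applied. *)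
Definition orbit_poly l : {poly {mpoly R[n]}} :=
  \prod_(mu <- orbl l) ('X - (lin mu)%:P).

Lemma orbit_poly_invariant l k : rep_invariant (orbit_poly l)`_k.
Proof.
move=> w; rewrite -(coef_map (comp_mpoly (act_tuple w))) /=.
suff -> : map_poly (comp_mpoly (act_tuple w)) (orbit_poly l) = orbit_poly l by [].
rewrite /orbit_poly rmorph_prod /= -[RHS](perm_big _ (perm_orbl l w)) /= big_map.
by apply: eq_bigr => mu _; rewrite map_polyXsubC /= lin_act.
Qed.

Definition orbit_diff l : {mpoly R[n]} :=
  \prod_(mu <- rem l (orbl l)) (lin l - lin mu).

Lemma mderiv_exp (x : {mpoly R[n]}) k j :
  (x ^+ k)^`M(j) = (x ^+ k.-1 *+ k) * x^`M(j).
Proof.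
elim: k => [|k IH]; first by rewrite expr0 mulr0n mul0r -[1]mpolyC1 mderivC.
rewrite exprS mderivM IH mulrA mulrnAr; case: k {IH} => [|k].
  by rewrite mulr0n mul0r addr0 mulrC.
by rewrite /= -exprS [x^`M(j) * _]mulrC -mulrDl -mulrS.
Qed.

Lemma mderiv_horner (p : {poly {mpoly R[n]}}) (x : {mpoly R[n]}) j :
  (p.[x])^`M(j) =
  \sum_(k < size p) (p`_k)^`M(j) * x ^+ k + p^`().[x] * x^`M(j).
Proof.
have dp : p^`().[x] = \sum_(k < size p) p`_k * (x ^+ k.-1 *+ k).
  have -> : p^`() = \sum_(k < size p) (p`_k *: 'X^k)^`().
    by rewrite -[in LHS](coefK p) poly_def; apply: (big_morph _ (@derivD _) (@deriv0 _)).
  rewrite horner_sum; apply: eq_bigr => k _.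
  by rewrite derivZ derivXn hornerZ hornerMn hornerXn.
rewrite horner_coef raddf_sum dp mulr_suml -big_split; apply: eq_bigr => k _ /=.
by rewrite mderivM mderiv_exp mulrA.
Qed.

Variable f : n.-tuple {mpoly R[n]}.
Hypothesis fgen : forall p, rep_invariant p -> exists g : {mpoly R[n]}, p = g \mPo f.

Definition jac_mx : 'M[{mpoly R[n]}]_n := \matrix_(i, j) (tnth f i)^`M(j).
Definition jac := \det jac_mx.

(* Differentiate [(orbit_poly l).[lin l] = 0] with the coefficients of
   [orbit_poly l] written as polynomials in [f]. *)
Lemma orbit_diff_span l : exists a : 'I_n -> {mpoly R[n]},
  forall j, orbit_diff l * (l 0 j)%:MP = \sum_i a i * (tnth f i)^`M(j).
Proof.
have [psi chiE psiE] : exists2 psi : {poly {mpoly R[n]}},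
    orbit_poly l = ('X - (lin l)%:P) * psi & psi.[lin l] = orbit_diff l.
  exists (\prod_(mu <- rem l (orbl l)) ('X - (lin mu)%:P)).
    by rewrite /orbit_poly (perm_big _ (perm_to_rem (orbl_refl l))) big_cons.
  by rewrite horner_prod; apply: eq_bigr => mu _; rewrite hornerXsubC.
have [g gE] : exists g : 'I_(size (orbit_poly l)) -> {mpoly R[n]},
    forall k : 'I_(size (orbit_poly l)), (orbit_poly l)`_k = g k \mPo f.
  apply: (fin_all_exists (P := fun (k : 'I_(size (orbit_poly l)))
    (g : {mpoly R[n]}) => (orbit_poly l)`_k = g \mPo f)) => k.
  exact/fgen/orbit_poly_invariant.
exists (fun i => - \sum_k ((g k)^`M(i) \mPo f) * lin l ^+ k) => j.
have := mderiv_horner (orbit_poly l) (lin l) j.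
have -> : (orbit_poly l).[lin l] = 0 by rewrite chiE !hornerE subrr mul0r.
have -> : (orbit_poly l)^`().[lin l] = orbit_diff l.
  by rewrite chiE derivM derivXsubC !hornerE subrr mul0r addr0 psiE.
rewrite mderiv0 mderiv_lin => /esym/eqP; rewrite addrC addr_eq0 => /eqP ->.
under eq_bigr => k _ do rewrite gE mderiv_comp mulr_suml.
rewrite exchange_big /= -sumrN; apply: eq_bigr => i _.
rewrite mulNr mulr_suml; congr (- _); apply: eq_bigr => k _.
by rewrite mulrAC.
Qed.

(** For the n rows of [L], [orbit_diff_span] is a matrix identity: a diagonal matrix times [L] is a
    multiple of the Jacobian matrix. Its determinant shows that J divides a product of linear forms
    when [L] is invertible, and [L] can still be chosen. *)
Lemma jac_dvd (L : 'M[R]_n) : exists q : {mpoly R[n]},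
  q * jac = (\prod_i orbit_diff (row i L)) * (\det L)%:MP.
Proof.
have [a aE] := fin_all_exists (fun i => orbit_diff_span (row i L)).
exists (\det (\matrix_(i, j) a i j)); rewrite -det_mulmx.
have -> : (\det L)%:MP = \det (map_mx (@mpolyC n R) L) :> {mpoly R[n]}.
  by rewrite -det_map_mx.
have -> : \prod_i orbit_diff (row i L) = \det (diag_mx (\row_i orbit_diff (row i L))).
  by rewrite det_diag; apply: eq_bigr => i _; rewrite mxE.
rewrite -det_mulmx; congr (\det _); apply/matrixP => i j.
have := aE i j; rewrite mxE mul_diag_mx !mxE => ->.
by apply: eq_bigr => k _; rewrite !mxE.
Qed.

End Jacobian.

(** * Generic bases of linear forms *)

Section GenericBasis.
Variables (R : realFieldType) (n : nat).

Lemma det_add_rank1 (A : 'M[R]_n) (c : 'cV[R]_n) (r : 'rV[R]_n) :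
  A \in unitmx -> \det (A + c *m r) = \det A * (1 + (r *m (invmx A *m c)) 0 0).
Proof.
move=> uA; have -> : A + c *m r = A *m (1%:M + (invmx A *m c) *m r).
  by rewrite mulmxDr mulmx1 -mulmxA mulKVmx.
by rewrite det_mulmx det_1D_mulmxC det_mx11 !mxE eqxx.
Qed.

Lemma mulmx_row i (A : 'M[R]_n) (v : 'cV[R]_n) :
  (row i A *m v) 0 0 = (A *m v) i 0.
Proof. by rewrite -row_mul mxE. Qed.

(** Adding [k] times [h] to every row makes all rows generic at once: invertibility excludes at most
    one [k], by the rank-one determinant formula, and so does each pair of a row and a [d], because
    h d is nonzero. *)
Lemma generic_basis (A : 'M[R]_n) (h : 'rV[R]_n) (s : seq 'cV[R]_n) :
    A \in unitmx -> {in s, forall d, h *m d != 0} ->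
  exists2 k : R, A + const_mx k *m h \in unitmx &
    forall i, {in s, forall d, row i (A + const_mx k *m h) *m d != 0}.
Proof.
move=> uA hs.
have [k] := avoid_scalars (- ((h *m (invmx A *m (const_mx 1 : 'cV[R]_n))) 0 0)^-1 ::
  [seq - ((A *m d) i 0 / (h *m d) 0 0) | i <- enum 'I_n, d <- s]).
rewrite inE negb_or => /andP[k0 ks].
have ck : const_mx k = k *: const_mx 1 :> 'cV[R]_n.
  by apply/matrixP => a b; rewrite !mxE mulr1.
exists k.
  rewrite unitmxE det_add_rank1 // unitrM -unitmxE uA /= unitfE.
  rewrite ck -!scalemxAr mxE; apply: contra k0 => e; apply/eqP.
  set x := (h *m _) 0 0 in e *.
  have x0 : x != 0 by apply: contraTneq e => ->; rewrite mulr0 addr0 oner_eq0.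
  apply: (mulIf x0); rewrite mulNr mulVf //.
  by move: e; rewrite addrC addr_eq0 => /eqP.
move=> i d ds; apply: contra ks => /eqP e. apply/allpairsPdep.
exists i, d; rewrite mem_enum; split=> //.
have hd : (h *m d) 0 0 != 0.
  by apply: contra (hs d ds) => /eqP hd; rewrite [h *m d]mx11_scalar hd raddf0.
apply: (mulIf hd); rewrite mulNr divfK //.
move/matrixP/(_ 0 0): e; rewrite mulmx_row mulmxDl [RHS]mxE mxE.
rewrite -mulmxA [h *m d]mx11_scalar mul_mx_scalar [X in _ + X]mxE.
rewrite [X in _ + _ * X]mxE.
by move/eqP; rewrite addrC addr_eq0 => /eqP <-; rewrite mxE eqxx mulr1n mulrC.
Qed.

End GenericBasis.

Lemma dhomog_mderiv (R : nzRingType) n d (p : {mpoly R[n]}) j :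
  p \is d.+1.-homog -> p^`M(j) \is d.-homog.
Proof.
move=> /dhomogP hp; apply/dhomogP => m; rewrite mcoeff_msupp mcoeff_mderiv.
move=> h; have : (m + U_(j))%MM \in msupp p.
  by rewrite mcoeff_msupp; apply: contraNneq h => ->; rewrite mul0rn.
move/hp => h'; have : mdeg (m + U_(j)) = d.+1 by [].
by rewrite mdegD mdeg1 addn1 => -[].
Qed.

(** * Invariant norm and reflections *)

Section JacobianZeros.
Variables (R : realFieldType) (n : nat) (W : finGroupType).
Variable rW : mx_representation R [set: W]%G n.
Implicit Types (g h w s : W) (z u v : 'cV[R]_n).

(** An invariant Euclidean norm obtained by averaging over the group; it serves a strict convexity
    argument about orbits. *)
Definition sqnorm v : R := \sum_(g : W) \sum_i ((rW g *m v) i 0) ^+ 2.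

Lemma sqnorm_act w v : sqnorm (rW w *m v) = sqnorm v.
Proof.
rewrite /sqnorm [RHS](reindex_inj (mulIg w)); apply: eq_bigr => g _.
by rewrite repM -mulmxA.
Qed.

Lemma sqnorm_eq0 v : sqnorm v = 0 -> v = 0.
Proof.
move=> /eqP; rewrite psumr_eq0 => [/allP/(_ 1%g (mem_index_enum _))|g _]; last first.
  by apply: sumr_ge0 => i _; apply: sqr_ge0.
rewrite rep1 mul1mx psumr_eq0 => [/allP h|i _]; last exact: sqr_ge0.
apply/colP => i; have := h i (mem_index_enum _).
by rewrite sqrf_eq0 => /eqP ->; rewrite mxE.
Qed.

Lemma sqnorm_parallelogram a b :
  sqnorm (a + b) + sqnorm (a - b) = (sqnorm a + sqnorm b) *+ 2.
Proof.
rewrite /sqnorm -!big_split -sumrMnl; apply: eq_bigr => g _ /=.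
rewrite -!big_split -sumrMnl; apply: eq_bigr => i _ /=.
by rewrite mulmxBr mulmxDr !mxE; ring.
Qed.

Lemma sqnorm_strict_convex a b z :
  sqnorm a = sqnorm z -> sqnorm b = sqnorm z -> a + b = 2%:R *: z -> a = z.
Proof.
move=> az bz abz; have := sqnorm_parallelogram a b; rewrite az bz abz.
have -> : sqnorm (2%:R *: z) = 4%:R * sqnorm z.
  rewrite /sqnorm mulr_sumr; apply: eq_bigr => g _; rewrite mulr_sumr.
  by apply: eq_bigr => i _; rewrite -scalemxAr mxE; ring.
move=> e; have /sqnorm_eq0/eqP : sqnorm (a - b) = 0.
  have : 4%:R * sqnorm z + sqnorm (a - b) = 4%:R * sqnorm z by rewrite e; ring.
  by rewrite -[RHS]addr0 => /addrI.
rewrite subr_eq0 => /eqP eab; move: abz.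
by rewrite -eab -mulr2n -scaler_nat => /scalerI; apply; rewrite pnatr_eq0.
Qed.

Lemma rank1_factor (S : 'M[R]_n) : \rank S = 1%N ->
  exists c : 'cV[R]_n, exists2 r : 'rV[R]_n, r != 0 & S = c *m r.
Proof.
move=> rk; move: (mulmx_base S) (row_base_free S).
move: (col_base S) (row_base S); rewrite rk => c r e fr; exists c, r => //.
by apply: contraTneq fr => ->; rewrite /row_free mxrank0.
Qed.

(** If S S = 0 then w^k = 1 + k S; taking for k the order of w gives k S = 0, so S = 0 in
    characteristic zero. *)
Lemma unipotent_eq1 w : (rW w - 1%:M) *m (rW w - 1%:M) = 0 -> rW w = 1%:M.
Proof.
set S := rW w - 1%:M => SS.
have wS : rW w = 1%:M + S by rewrite /S addrC subrK.
have wk k : rW (w ^+ k)%g = 1%:M + k%:R *: S.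
  elim: k => [|k IH]; first by rewrite expg0 rep1 scale0r addr0.
  rewrite expgSr repM IH wS mulmxDl mul1mx mulmxDr mulmx1 -scalemxAl SS.
  by rewrite scaler0 addr0 -addrA -natr1 scalerDl scale1r [S + _]addrC.
have := wk #[w]%g; rewrite expg_order rep1 -{1}[1%:M]addr0 => /addrI/esym/eqP.
rewrite scaler_eq0 pnatr_eq0 -leqn0 leqNgt order_gt0 /= => /eqP S0.
by rewrite wS S0 addr0.
Qed.

(* The order of [s] is finite: this excludes transvections and forces the
   determinant to be a real number of absolute value 1. *)
Lemma reflection_props s (c : 'cV[R]_n) (r : 'rV[R]_n) :
    r != 0 -> \rank (rW s - 1%:M) = 1%N -> rW s = 1%:M + c *m r ->
  [/\ (r *m c) 0 0 = - 2%:R, rW s *m rW s = 1%:M & \det (rW s) = - 1].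
Proof.
move=> r0 rk sE.
have SE : rW s - 1%:M = c *m r by rewrite sE addrC addKr.
have SS : (c *m r) *m (c *m r) = (r *m c) 0 0 *: (c *m r).
  rewrite -mulmxA [r *m (c *m r)]mulmxA [r *m c]mx11_scalar mul_scalar_mx.
  by rewrite scalemxAr; congr (_ *m (_ *: _)); rewrite [RHS]mxE ?eqxx ?mulr1n.
have detE : \det (rW s) = 1 + (r *m c) 0 0.
  by rewrite sE det_1D_mulmxC det_mx11 !mxE eqxx.
have rc0 : (r *m c) 0 0 != 0.
  apply/eqP => rc; have := @unipotent_eq1 s.
  rewrite SE SS rc scale0r => /(_ erefl) s1; move: rk.
  by rewrite s1 subrr mxrank0.
have detk k : \det (rW (s ^+ k)%g) = \det (rW s) ^+ k.
  elim: k => [|k IH]; first by rewrite expg0 rep1 det1.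
  by rewrite expgSr repM det_mulmx IH exprSr.
have d1 : `|\det (rW s)| = 1.
  have /esym/(congr1 Num.norm) := detk #[s]%g.
  rewrite expg_order rep1 det1 normrX normr1 => /eqP.
  by rewrite pexpr_eq1 ?normr_ge0 ?order_gt0 // => /eqP.
have rc2 : (r *m c) 0 0 = - 2%:R.
  move: d1 => /eqP; rewrite eqr_norml ler01 andbT detE => /orP[/eqP e|/eqP e].
    by move: rc0; rewrite -[_ 0 0](addKr 1) e addNr eqxx.
  by rewrite -[_ 0 0](addKr 1) e; ring.
split=> //; last by rewrite detE rc2; ring.
rewrite sE mulmxDl mul1mx mulmxDr mulmx1 SS rc2 -addrA -{1 2}[c *m r]scale1r.
by rewrite -!scalerDl (_ : 1 + (1 + -2) = 0) ?scale0r ?addr0 //; ring.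
Qed.

End JacobianZeros.

(** * Zeros of the Jacobian along lines *)

Section JacobianRoots.
Variables (R : realFieldType) (n : nat) (W : finGroupType).
Variable rW : mx_representation R [set: W]%G n.
Variables (f : n.-tuple {mpoly R[n]}) (m : 'I_n -> nat).
Hypothesis f_inv : forall i, rep_invariant rW (tnth f i).
Hypothesis f_gen :
  forall p, rep_invariant rW p -> exists g : {mpoly R[n]}, p = g \mPo f.
Hypothesis f_hom : forall i, tnth f i \is (m i).+1.-homog.
Implicit Types (g h w s : W) (z u v : 'cV[R]_n).

Local Notation J := (jac f).

Definition df z : 'M[R]_n := \matrix_(i, j) ev z (tnth f i)^`M(j).

Lemma ev_jac z : ev z J = \det (df z).
Proof.
rewrite /ev /jac -det_map_mx; congr (\det _).
by apply/matrixP => i j; rewrite !mxE.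
Qed.

Lemma line_jac z u : line z u J = \det (map_mx (line z u) (jac_mx f)).
Proof. by rewrite /jac -det_map_mx. Qed.

Lemma line_at0 p z u : (line z u p).[0] = ev z p.
Proof. by rewrite line_horner scale0r addr0. Qed.

(** The chain rule for f(w z) = f(z), read off in each coordinate direction from two equal
    restrictions to lines. *)
Lemma df_act w z : df (rW w *m z) *m rW w = df z.
Proof.
apply/matrixP => i j; pose u : 'cV[R]_n := delta_mx j 0.
have e : line (rW w *m z) (rW w *m u) (tnth f i) = line z u (tnth f i).
  apply: poly_eq_nat => k; rewrite !line_horner.
  by rewrite scalemxAr -mulmxDr -ev_act f_inv.
have := congr1 (fun p : {poly R} => p^`().[0]) e.
rewrite !line_deriv !horner_sum.
under eq_bigr do rewrite hornerZ line_at0.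
under [in X in _ = X]eq_bigr do rewrite hornerZ line_at0.
rewrite [X in _ = X](bigD1 j) //= [X in _ = _ + X]big1 => [|k kj].
  rewrite mxE !eqxx mul1r addr0 => e2; rewrite !mxE -e2.
  apply: eq_bigr => k _; rewrite mxE mulrC; congr (_ * _).
  by rewrite -colE mxE.
by rewrite mxE (negPf kj) mul0r.
Qed.

Lemma jac_act w z : ev (rW w *m z) J * \det (rW w) = ev z J.
Proof. by rewrite !ev_jac -det_mulmx df_act. Qed.

Definition grad z : 'rV[R]_n := \row_j ev z J^`M(j).

Lemma line_jac_deriv z u t : (line z u J)^`().[t] = (grad (z + t *: u) *m u) 0 0.
Proof.
rewrite line_deriv horner_sum mxE; apply: eq_bigr => j _.
by rewrite hornerZ line_horner mxE mulrC.
Qed.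

(** J changes sign under s; differentiating this at a fixed point of s negates the gradient, which
    is therefore normal to the mirror. *)
Lemma grad_reflection s z : rW s *m z = z -> \det (rW s) = -1 ->
  grad z *m rW s = - grad z.
Proof.
move=> sz ds; apply/rowP => j; pose u : 'cV[R]_n := delta_mx j 0.
have e : line z (rW s *m u) J = - line z u J.
  apply: poly_eq_nat => k; rewrite hornerN !line_horner.
  rewrite -{1}sz scalemxAr -mulmxDr -[in RHS](jac_act s) ds.
  by rewrite mulrN1 opprK.
have := congr1 (fun p : {poly R} => p^`().[0]) e.
rewrite derivN hornerN !line_jac_deriv !scale0r !addr0.
by rewrite mulmxA -!colE !mxE => ->.
Qed.

Definition regular z := forall g, rW g *m z = z -> g = 1%g.

Lemma line_orbit_diff l z u : line z u (orbit_diff rW l) =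
  \prod_(mu <- rem l (orbl rW l))
     ((((l - mu) *m z) 0 0)%:P + ((l - mu) *m u) 0 0 *: 'X).
Proof.
rewrite /orbit_diff rmorph_prod /=; apply: eq_bigr => mu _.
by rewrite lin_inj_sub line_lin.
Qed.

Lemma rem_orblP l mu : mu \in rem l (orbl rW l) -> mu != l /\ exists g, mu = l *m rW g.
Proof.
rewrite mem_rem_uniq ?undup_uniq // => /andP[nl /orblP[g e]].
by split => //; exists g.
Qed.

(** The identity matrix is perturbed by a form [h] vanishing on no u - g u. For such a basis no
    factor of the products in [jac_dvd] vanishes at [u]. *)
Lemma regular_basis u : regular u -> exists2 L : 'M[R]_n, L \in unitmx &
  forall i g, g != 1%g -> (row i L *m u) 0 0 != (row i L *m (rW g *m u)) 0 0.
Proof.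
move=> ru; pose s := [seq u - rW g *m u | g <- enum [set: W] & g != 1%g].
have sn0 : {in s, forall d, d != 0}.
  move=> d /mapP[g]; rewrite mem_filter => /andP[g1 _] ->.
  by rewrite subr_eq0 eq_sym; apply: contra g1 => /eqP/ru/eqP.
have [h hs] : exists h : 'rV[R]_n, {in s, forall d, h *m d != 0}.
  have [|v hv] := @avoid_forms R n [seq d^T | d <- s].
    by move=> a /mapP[d /sn0 d0 ->]; rewrite trmx_eq0.
  exists v^T => d ds; rewrite -trmx_eq0 trmx_mul trmxK.
  by apply: hv; rewrite map_f.
have [k uL hL] := @generic_basis R n 1%:M h s (unitmx1 _ _) hs.
exists (1%:M + const_mx k *m h) => // i g g1.
apply/eqP => e; have /negP : row i (1%:M + const_mx k *m h) *m (u - rW g *m u) != 0.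
  by apply: hL; apply/mapP; exists g => //; rewrite mem_filter g1 mem_enum inE.
apply; apply/eqP; rewrite [LHS]mx11_scalar mulmxBr [X in X%:M](_ : _ = 0) ?raddf0 //.
by rewrite mxE [X in _ + X]mxE e subrr.
Qed.

Lemma jac_regular z : regular z -> ev z J != 0.
Proof.
move=> rz; have [L uL hL] := regular_basis rz.
have [q qJ] := jac_dvd f_gen L; apply/eqP => Jz.
have := congr1 (ev z) qJ; rewrite /ev mevalM -/(ev z J) Jz mulr0 mevalM mevalC.
move/esym/eqP; rewrite mulf_eq0 -[\det L == 0]negbK -unitfE -unitmxE uL orbF.
rewrite rmorph_prod /= => /prodf_eq0[i _].
rewrite -/(ev z _) -(line_at0 _ _ 0) line_orbit_diff horner_prod.
apply/negP; rewrite prodf_seq_neq0; apply/allP => mu /rem_orblP[ml [g e]].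
rewrite !hornerE e mulmxBl -mulmxA mxE [X in _ + X]mxE subr_eq0 hL //.
by apply: contraNneq ml => g1; rewrite e g1 rep1 mulmx1.
Qed.

(** Splitting over [R] itself: the residue sums need no algebraic closure. *)
Definition splits (p : {poly R}) :=
  exists2 s, p != 0 & p = lead_coef p *: \prod_(a <- s) ('X - a%:P).

Lemma splits_XD (a b : R) : b != 0 -> splits (a%:P + b *: 'X).
Proof.
move=> b0; have -> : a%:P + b *: 'X = b *: ('X - (- a / b)%:P).
  rewrite scalerBr addrC mulNr polyCN scalerN opprK -mul_polyC -[b *: (a / b)%:P]mul_polyC.
  by rewrite -polyCM [b * _]mulrC divfK.
exists [:: - a / b]; first by rewrite scaler_eq0 negb_or b0 polyXsubC_eq0.
by rewrite big_seq1 lead_coefZ lead_coefXsubC mulr1.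
Qed.

Lemma splits_prod I (r : seq I) (P : pred I) (F : I -> {poly R}) :
  (forall i, P i -> splits (F i)) -> splits (\prod_(i <- r | P i) F i).
Proof.
move=> sF; apply: big_ind => [|p q [s p0 ep] [t q0 eq]|//].
  by exists [::]; rewrite ?oner_eq0 // lead_coef1 big_nil scale1r.
exists (s ++ t); first by rewrite mulf_neq0.
by rewrite {1}ep {1}eq lead_coefM big_cat -scalerAl -scalerAr scalerA.
Qed.

Lemma splits_dvd (p q : {poly R}) : splits q -> p %| q -> splits p.
Proof.
move=> [s q0 eq] pq.
have lq : lead_coef q != 0 by rewrite lead_coef_eq0.
move: pq; rewrite eq dvdpZr // => /dvdp_prod_XsubC[t pt].
have p0 : p != 0.
  by apply: contraTneq pt => ->; rewrite eqp_sym eqp0 monic_neq0 ?monic_prod_XsubC.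
exists (mask t s) => //; have /eqpfP := pt.
by rewrite (monicP (monic_prod_XsubC _ _ _)) divr1.
Qed.

Lemma uniq_simple_roots (s : seq R) :
    {in s, forall a, (\prod_(b <- s) ('X - b%:P))^`().[a] != 0} -> uniq s.
Proof.
elim: s => //= a s IH h; pose p := \prod_(b <- s) ('X - b%:P).
have h' b : b \in a :: s -> p.[b] + (b - a) * p^`().[b] != 0.
  move=> /h; rewrite big_cons -/p derivM derivXsubC mul1r hornerD hornerM.
  by rewrite hornerXsubC.
apply/andP; split.
  have := h' a (mem_head _ _); rewrite subrr mul0r addr0 -rootE.
  by rewrite root_prod_XsubC.
apply: IH => b bs; have := h' b; rewrite inE bs orbT => /(_ isT).
have /eqP -> : p.[b] == 0 by rewrite -rootE root_prod_XsubC.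
by rewrite add0r mulf_eq0 => /norP[].
Qed.

Let D := (\sum_i m i)%N.

Lemma line_jac_size z u : (size (line z u J) <= D.+1)%N.
Proof.
rewrite line_jac; apply: (det_poly_coef _).1 => i j; rewrite !mxE.
by apply: (line_homog _ _ _).1; apply: dhomog_mderiv.
Qed.

Lemma line_jac_coef z u : (line z u J)`_D = ev u J.
Proof.
rewrite line_jac (det_poly_coef _).2 => [|i j]; last first.
  by rewrite !mxE; apply: (line_homog _ _ _).1; apply: dhomog_mderiv.
rewrite ev_jac; congr (\det _); apply/matrixP => i j; rewrite !mxE.
by apply: (line_homog _ _ _).2; apply: dhomog_mderiv.
Qed.

Lemma line_jac_lead z u : regular u ->
  size (line z u J) = D.+1 /\ lead_coef (line z u J) = ev u J.
Proof.
move=> /jac_regular; rewrite -(line_jac_coef z) => JD.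
have sz : size (line z u J) = D.+1.
  apply/eqP; rewrite eqn_leq line_jac_size ltnNge; apply: contra JD => h.
  by rewrite nth_default.
by rewrite lead_coefE sz.
Qed.

(** The restriction divides a product of restricted linear forms, each of degree exactly 1 because
    its slope is its value at the regular vector [u]. *)
Lemma line_jac_splits z u : regular u -> splits (line z u J).
Proof.
move=> ru; have [L uL hL] := regular_basis ru.
have [q qJ] := jac_dvd f_gen L.
have dL : \det L != 0 by rewrite -unitfE -unitmxE.
have := congr1 (line z u) qJ; rewrite !lineM lineC mulrC => e.
apply: (@splits_dvd _ (\prod_i line z u (orbit_diff rW (row i L)))).
  apply: splits_prod => i _; rewrite line_orbit_diff big_seq.
  apply: splits_prod => mu /rem_orblP[ml [g eg]]; apply: splits_XD.
  rewrite eg mulmxBl -mulmxA mxE [X in _ + X]mxE subr_eq0 hL //.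
  by apply: contraNneq ml => g1; rewrite eg g1 rep1 mulmx1.
have : line z u J %| (\prod_i line z u (orbit_diff rW (row i L))) * (\det L)%:P.
  by rewrite -rmorph_prod -e dvdp_mulr.
by rewrite mulrC mul_polyC dvdpZr.
Qed.
Lemma jac_fixed_reflection s z : rW s *m z = z -> \det (rW s) = -1 -> ev z J = 0.
Proof.
move=> sz ds; have := jac_act s z; rewrite sz ds mulrN1 => /eqP.
by rewrite eq_sym -addr_eq0 -mulr2n mulrn_eq0 => /eqP.
Qed.

(* [jac_dvd] for a basis all of whose members but one are fixed by [s] exhibits
   [z] as a simple zero along [u]. *)
Lemma jac_simple_zero s z u :
    rW s *m z = z -> \rank (rW s - 1%:M) = 1%N -> rW s *m u <> u ->
    (forall g, rW g *m z = z -> g = 1%g \/ g = s) ->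
  (grad z *m u) 0 0 != 0.
Proof.
move=> sz rk su stab; pose S := rW s - 1%:M.
have [c [r r0 SE]] := rank1_factor rk.
have sE : rW s = 1%:M + c *m r by rewrite -SE addrC subrK.
have [rc ss ds] := reflection_props r0 rk sE.
have sS : (1%:M + rW s) *m S = 0.
  by rewrite mulmxDl mul1mx /S mulmxBr ss mulmx1 addrA subrK subrr.
pose disp := [seq z - rW g *m z | g <- enum [set: W] & (g != 1%g) && (g != s)].
(* An [s]-invariant form, obtained by symmetrizing a generic one. It can be nonzero on d = z - g z
   because d + s d = 0 would make z the midpoint of g z and s g z, which have the same norm as z,
   and strict convexity would force g z = z. *)
have [h hS hd] : exists2 h : 'rV[R]_n, h *m S = 0 & {in disp, forall d, h *m d != 0}.
  have [|v hv] := @avoid_forms R n [seq (d + rW s *m d)^T | d <- disp].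
    move=> a /mapP[d /mapP[g]]; rewrite mem_filter => /andP[/andP[g1 gs] _] -> -> {a d}.
    rewrite trmx_eq0; apply/eqP => e.
    have gz : rW g *m z = z.
      apply: (@sqnorm_strict_convex R n W rW _ (rW s *m (rW g *m z))); rewrite ?sqnorm_act //.
      move: e; rewrite mulmxBr sz addrACA -opprD => /eqP.
      by rewrite subr_eq0 => /eqP <-; rewrite scaler_nat mulr2n.
    by case: (stab g gz) => /eqP; apply/negP.
  exists (v^T *m (1%:M + rW s)); first by rewrite -mulmxA sS mulmx0.
  move=> d dd; have := hv _ (map_f (fun d => (d + rW s *m d)^T) dd).
  rewrite -trmx_eq0 trmx_mul trmxK.
  by rewrite -mulmxA mulmxDl mul1mx.
(* As S has rank 1, all rows of [L0] but the first kill S, that is, are fixed by s. Adding multiples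
   of [h] preserves this. *)
pose L0 := invmx (col_ebase S).
have uL0 : L0 \in unitmx by rewrite unitmx_inv col_ebase_unit.
have L0S : L0 *m S = pid_mx 1 *m row_ebase S.
  by rewrite -{1}(mulmx_ebase S) rk -!mulmxA mulKmx ?col_ebase_unit.
have [k uL hL] := generic_basis uL0 hd.
move: uL hL; set L := L0 + _ => uL hL.
have LS : L *m S = pid_mx 1 *m row_ebase S.
  by rewrite mulmxDl -mulmxA hS mulmx0 addr0.
have fixL (i : 'I_n) : i != 0%N :> nat -> row i L *m rW s = row i L.
  move=> i0; apply/eqP; rewrite -subr_eq0 -{2}[row i L]mulmx1 -mulmxBr -row_mul.
  rewrite LS row_mul; apply/eqP; rewrite [row i _](_ : _ = 0) ?mul0mx //.
  by apply/rowP => j; rewrite !mxE ltnS leqn0 (negPf i0) andbF.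
have n0 : (0 < n)%N.
  by rewrite (leq_trans _ (rank_leq_row (rW s - 1%:M))) // rk.
pose i0 := Ordinal n0; set l := row i0 L.
have ls : l *m rW s != l.
  apply/eqP => e; move: rk; suff S0 : L *m S = 0.
    rewrite -/S -[S](mulKmx uL) S0 mulmx0 mxrank0 //.
  apply/row_matrixP => i; rewrite row_mul row0.
  have [i0'|/fixL e'] := eqVneq (i : nat) 0%N.
    have -> : i = i0 by apply: val_inj.
    by rewrite mulmxBr mulmx1 -/l e subrr.
  by rewrite mulmxBr mulmx1 e' subrr.
have generic i g : row i L *m rW g != row i L -> g != s ->
    ((row i L - row i L *m rW g) *m z) 0 0 != 0.
  move=> ml gs; have g1 : g != 1%g.
    by apply: contraNneq ml => ->; rewrite rep1 mulmx1.
  have /(hL i) : z - rW g *m z \in disp.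
    by apply/mapP; exists g => //; rewrite mem_filter g1 gs mem_enum inE.
  rewrite mulmxBl -mulmxA -mulmxBr; apply: contra => /eqP e.
  by rewrite [_ *m _]mx11_scalar e raddf0.
have [q qJ] := jac_dvd f_gen L.
apply/eqP => gz.
have := congr1 (line z u) qJ; rewrite !lineM lineC => e.
(* With zero derivative of J along u, the product of linear forms would have a double zero at z. But
   only the factor of l - l s vanishes there, and its slope is nonzero since s moves both l and
   u. *)
have /eqP : (line z u q * line z u J)^`().[0] = 0.
  rewrite derivM hornerD !hornerM line_jac_deriv scale0r addr0 gz mulr0 addr0.
  by rewrite line_at0 (jac_fixed_reflection sz ds) mulr0.
rewrite e mulrC mul_polyC derivZ hornerZ mulf_eq0 -[\det L == 0]negbK -unitfE.
rewrite -unitmxE uL /= rmorph_prod (bigD1 i0) //= line_orbit_diff.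
have lsr : l *m rW s \in rem l (orbl rW l).
  rewrite mem_rem_uniq ?undup_uniq // inE ls /=.
  by apply/orblP; exists s.
rewrite (perm_big _ (perm_to_rem lsr)) big_cons /=.
have -> : ((l - l *m rW s) *m z) 0 0 = 0.
  by rewrite mulmxBl -mulmxA sz subrr mxE.
rewrite polyC0 add0r -mulrA -scalerAl derivZ hornerZ derivM derivX mul1r.
rewrite hornerD !hornerM hornerX mul0r addr0 !mulf_eq0.
apply/negP; rewrite !negb_or; apply/and3P; split.
- have -> : ((l - l *m rW s) *m u) 0 0 = - ((l *m c) 0 0 * (r *m u) 0 0).
    rewrite sE mulmxDr mulmx1 opprD addrA subrr add0r mulNmx mxE; congr (- _).
    rewrite (mulmxA l) -(mulmxA (l *m c)) [l *m c]mx11_scalar mul_scalar_mx.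
    by rewrite mxE [in RHS]mxE eqxx mulr1n.
  rewrite oppr_eq0 mulf_eq0 negb_or.
  apply/andP; split.
    apply: contra ls => /eqP lc; rewrite sE mulmxDr mulmx1 mulmxA.
    by rewrite [l *m c]mx11_scalar lc raddf0 mul0mx addr0.
  apply/eqP => ru; apply: su; rewrite sE mulmxDl mul1mx -mulmxA.
  by rewrite [r *m u]mx11_scalar ru raddf0 mulmx0 addr0.
- rewrite horner_prod prodf_seq_neq0; apply/allP => mu.
  rewrite mem_rem_uniq ?rem_uniq ?undup_uniq // => /andP[mls].
  case/rem_orblP=> ml [g eg]; rewrite !hornerE eg generic -?eg //.
  by apply: contraNneq mls => gs; rewrite eg gs.
- rewrite horner_prod prodf_seq_neq0; apply/allP => i _; apply/implyP => ii0.
  rewrite line_orbit_diff horner_prod prodf_seq_neq0; apply/allP => mu.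
  case/rem_orblP=> ml [g eg]; rewrite !hornerE eg generic -?eg //.
  apply: contraNneq ml => gs; rewrite eg gs fixL //.
Qed.
End JacobianRoots.

(** * Euler-Jacobi relation and Solomon's formula *)

Lemma avoid_kernels (R : realFieldType) n (I : finType) (k : I -> nat)
    (N : forall i, 'M[R]_(k i, n)) :
  exists v : 'cV[R]_n, forall i, N i != 0 -> N i *m v != 0.
Proof.
have [|v hv] := @avoid_forms R n [seq nz_row (N i) | i <- enum I & N i != 0].
  by move=> a /mapP[i]; rewrite mem_filter => /andP[Ni _] ->; rewrite nz_row_eq0.
exists v => i Ni; have /hv : nz_row (N i) \in [seq nz_row (N i) | i <- enum I & N i != 0].
  by apply/mapP; exists i => //; rewrite mem_filter Ni mem_enum.
have /submxP[X ->] := nz_row_sub (N i).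
by apply: contraNneq => e; rewrite -mulmxA e mulmx0.
Qed.

(** * The points z_w and generic lines of parameters *)

Section GenericLines.
Variables (R : realFieldType) (n : nat) (W : finGroupType).
Variable rW : mx_representation R [set: W]%G n.
Hypothesis rW_inj : forall g, rW g = 1%:M -> g = 1%g.
Implicit Types (g h w s : W) (z u v c : 'cV[R]_n).

Local Notation regular := (regular rW).

(** Both elements have the form 1 + c r with the same row r and r c = -2. Their product is 1 + (d -
    c) r with r (d - c) = 0, hence unipotent, hence trivial. *)
Lemma common_fixed_hyperplane g h : g != 1%g -> h != 1%g ->
    (\rank (col_mx (rW g - 1%:M) (rW h - 1%:M)) <= 1)%N ->
  g = h /\ \rank (rW g - 1%:M) = 1%N.
Proof.
move=> g1 h1; set Q := col_mx _ _ => rQ.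
have rk_ge1 x : x != 1%g -> (0 < \rank (rW x - 1%:M)%R)%N.
  move=> x1; rewrite lt0n mxrank_eq0 subr_eq0.
  by apply: contra x1 => /eqP/rW_inj/eqP.
have gQ : (rW g - 1%:M <= Q)%MS by rewrite -addsmxE addsmxSl.
have hQ : (rW h - 1%:M <= Q)%MS by rewrite -addsmxE addsmxSr.
have rg : \rank (rW g - 1%:M) = 1%N.
  by apply/eqP; rewrite eqn_leq rk_ge1 // (leq_trans (mxrankS gQ)).
have rh : \rank (rW h - 1%:M) = 1%N.
  by apply/eqP; rewrite eqn_leq rk_ge1 // (leq_trans (mxrankS hQ)).
split=> //; have [c [r r0 gE]] := rank1_factor rg.
have hg : (rW h - 1%:M <= rW g - 1%:M)%MS.
  by rewrite (submx_trans hQ) // -(geq_leqif (mxrank_leqif_sup gQ)) rg.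
have [X] := submxP hg; rewrite gE mulmxA; set d := X *m c => hE.
have gE' : rW g = 1%:M + c *m r by rewrite -gE addrC subrK.
have hE' : rW h = 1%:M + d *m r by rewrite -hE addrC subrK.
have [rc gg _] := reflection_props r0 rg gE'.
have [rd hh _] := reflection_props r0 rh hE'.
have rs (a : 'cV[R]_n) : (r *m a) 0 0 = - 2%:R -> r *m a = (- 2%:R)%:M.
  by rewrite [r *m a]mx11_scalar => <-; rewrite [in RHS]mxE eqxx mulr1n.
have ghE : rW (g * h)%g - 1%:M = (d - c) *m r.
  have pq : (c *m r) *m (d *m r) = - 2%:R *: (c *m r).
    by rewrite -mulmxA (mulmxA r) rs // mul_scalar_mx -scalemxAr.
  rewrite repM gE' hE' [RHS]mulmxBl; move: pq; set p := c *m r; set q := d *m r.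
  move=> pq; rewrite mulmxDl mul1mx mulmxDr mulmx1 pq scaleNr scaler_nat mulr2n.
  rewrite opprD (addrA p) subrr add0r -addrA [- p - _]addrC.
  by rewrite addrACA subrr add0r.
have : rW (g * h)%g = 1%:M.
  apply: (@unipotent_eq1 _ _ _ rW (g * h)%g).
  have rdc : r *m (d - c) = 0 by rewrite mulmxBr (rs d) // (rs c) // subrr.
  by rewrite ghE -mulmxA (mulmxA r) rdc mul0mx mulmx0.
move/rW_inj/eqP; rewrite -eq_invg_mul => /eqP <-.
apply/eqP; rewrite eq_sym eq_invg_mul; apply/eqP/rW_inj.
by rewrite repM gg.
Qed.

Variable t : R.
Hypothesis t01 : 0 < t < 1.

Definition shifted w : 'M[R]_n := rW w^-1%g - t%:M.

Lemma det_shifted w : \det (1%:M - t *: rW w) = \det (rW w) * \det (shifted w).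
Proof.
rewrite -det_mulmx /shifted mulmxBr repKV mul_mx_scalar //.
Qed.

Lemma shifted_unit w : shifted w \in unitmx.
Proof.
have := det_1Bt_neq0 rW w t01; rewrite det_shifted mulf_eq0 => /norP[_ d0].
by rewrite unitmxE unitfE.
Qed.

(** The point z_w. It is linear in [c], so a line of parameters c0 + a c1 gives, for each w, a line
    of points. *)
Definition sol c w : 'cV[R]_n := invmx (shifted w) *m c.

Lemma solP c w z : rW w^-1%g *m z = t *: z + c <-> z = sol c w.
Proof.
split=> [e|->].
  rewrite /sol -[LHS](mulKmx (shifted_unit w)) mulmxBl e mul_scalar_mx.
  by rewrite addrC addKr.
have : shifted w *m sol c w = c by rewrite mulKVmx // shifted_unit.
by rewrite mulmxBl mul_scalar_mx => /eqP; rewrite subr_eq addrC => /eqP.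
Qed.

(** A generic line misses every flat of codimension at least 2. The direction [c1] is chosen before
    [c0], since the conditions on [c0] arise by eliminating a and depend on it. *)
Lemma exists_generic_lines : exists c0 : 'cV[R]_n, exists c1 : 'cV[R]_n,
  [/\ forall w, regular (sol c0 w), forall w, regular (sol c1 w)
    & forall w a g h, let z := sol c0 w + a *: sol c1 w in
        g != 1%g -> h != 1%g -> rW g *m z = z -> rW h *m z = z ->
      g = h /\ \rank (rW g - 1%:M) = 1%N].
Proof.
pose N (p : W * W) := (rW p.1 - 1%:M) *m invmx (shifted p.2).
have N0 p : p.1 != 1%g -> N p != 0.
  apply: contra => /eqP/(congr1 (mulmx^~ (shifted p.2))).
  rewrite mul0mx mulmxKV ?shifted_unit // => /eqP; rewrite subr_eq0 => /eqP.
  by move/rW_inj ->.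
have reg c : (forall p, N p != 0 -> N p *m c != 0) -> forall w, regular (sol c w).
  move=> hc w g e; apply/eqP; apply: contraT => g1.
  have /negP[] := hc (g, w) (N0 (g, w) g1).
  by rewrite -mulmxA mulmxBl mul1mx -/(sol c w) e subrr.
have [c1 hc1] := avoid_kernels N.
pose Q (p : W * W) := col_mx (rW p.1 - 1%:M) (rW p.2 - 1%:M).
pose q (p : W * (W * W)) := Q p.2 *m sol c1 p.1.
(* The combinations of the rows of [Q] that kill the direction of the line, as forms in [c0]. One of
   them is nonzero if [Q] has rank at least 2, since killing one column costs at most one
   dimension. *)
pose K (p : W * (W * W)) := kermx (q p) *m Q p.2 *m invmx (shifted p.1).
pose NK (p : (W * W) + W * (W * W)) : 'M[R]_(if p is inl _ then n else n + n, n) :=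
  match p with inl x => N x | inr x => K x end.
have [c0 hc0] := avoid_kernels NK.
exists c0, c1; split; [|exact: reg|].
  by apply: reg => p; apply: (hc0 (inl p)).
move=> w a g h z g1 h1 gz hz; apply: common_fixed_hyperplane => //.
rewrite leqNgt; apply/negP => rk2.
have Qz : Q (g, h) *m z = 0.
  by rewrite mul_col_mx !mulmxBl !mul1mx gz hz !subrr col_mx0.
have /(hc0 (inr (w, (g, h))))/negP[] : NK (inr (w, (g, h))) != 0.
  apply/eqP => /= K0.
  have : kermx (q (w, (g, h))) *m Q (g, h) = 0.
    have K0' : kermx (q (w, (g, h))) *m Q (g, h) *m invmx (shifted w) = 0 := K0.
    by rewrite -[LHS](mulmxKV (shifted_unit w)) K0' mul0mx.
  move/sub_kermxP/mxrankS; rewrite !mxrank_ker.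
  have : (\rank (q (w, (g, h))) <= 1)%N := rank_leq_col _.
  have := rank_leq_row (Q (g, h)); move: rk2; rewrite -/(Q (g, h)); lia.
have sE : sol c0 w = z - a *: sol c1 w by rewrite /z addrK.
have kq : kermx (q (w, (g, h))) *m (Q (g, h) *m sol c1 w) = 0 by exact: mulmx_ker.
suff -> : NK (inr (w, (g, h))) *m c0 = kermx (q (w, (g, h))) *m (Q (g, h) *m sol c0 w).
  by rewrite sE [Q _ *m _]mulmxBr Qz sub0r -scalemxAr mulmxN -scalemxAr kq scaler0 oppr0.
by rewrite /sol !mulmxA.
Qed.

End GenericLines.

(** * Cancellation of residues and the two-parameter identity *)

Section Solomon.
Variables (R : realFieldType) (n : nat) (W : finGroupType).
Variable rW : mx_representation R [set: W]%G n.
Variables (f : n.-tuple {mpoly R[n]}) (m : 'I_n -> nat).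
Hypothesis f_inv : forall i, rep_invariant rW (tnth f i).
Hypothesis f_gen :
  forall p, rep_invariant rW p -> exists g : {mpoly R[n]}, p = g \mPo f.
Hypothesis f_hom : forall i, tnth f i \is (m i).+1.-homog.
Hypothesis rW_inj : forall g, rW g = 1%:M -> g = 1%g.
Implicit Types (g h w s : W) (z u v c : 'cV[R]_n).

Local Notation J := (jac f).
Local Notation regular := (regular rW).
Let D := (\sum_i m i)%N.

Variable t : R.
Hypothesis t01 : 0 < t < 1.
Local Notation sh := (shifted rW t).
Local Notation sl := (sol rW t).

(* The point [z] of the hyperplane fixed by [s] lies on the lines of both [w]
   and [s * w]; this is the cancellation of the two residues there. *)
Lemma residues_cancel s w z c1 :
    \rank (rW s - 1%:M) = 1%N -> rW s *m z = z ->
  \det (1%:M - t *: rW (s * w)%g) * (grad f z *m sl c1 (s * w)%g) 0 0 =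
  - (\det (1%:M - t *: rW w) * (grad f z *m sl c1 w) 0 0).
Proof.
move=> rk sz; have [c [r r0 SE]] := rank1_factor rk.
have sE : rW s = 1%:M + c *m r by rewrite -SE addrC subrK.
have [rc ss ds] := reflection_props r0 rk sE.
have sV : rW s^-1%g = rW s.
  by rewrite -[LHS]mulmx1 -ss mulmxA repVK mul1mx.
have [k gE] : exists k, grad f z = k *: r.
  exists (- (2%:R^-1 * (grad f z *m c) 0 0)).
  have := grad_reflection f_inv sz ds.
  rewrite sE mulmxDr mulmx1 mulmxA => /eqP; rewrite -subr_eq0 opprK addrAC.
  rewrite -mulr2n -scaler_nat addr_eq0 => /eqP/(congr1 (fun x : 'rV_n => 2%:R^-1 *: x)).
  rewrite scalerA mulVf ?pnatr_eq0 // scale1r => {1}->.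
  by rewrite {1}[grad f z *m c]mx11_scalar mul_scalar_mx scalerN scalerA scaleNr.
pose p := rW w^-1%g *m c.
(* A rank-one update: passing from w to s w multiplies the determinant by 1 + x and divides the row
   r times the inverse by 1 + x. The factors cancel, and the sign left over is det s = -1. *)
have shE : sh (s * w)%g = sh w + p *m r.
  rewrite /shifted invMg repM sV sE mulmxDr mulmx1 addrAC /p mulmxA //.
have uA := shifted_unit rW t01 w; have uA' := shifted_unit rW t01 (s * w)%g.
set x := (r *m (invmx (sh w) *m p)) 0 0.
have dA' : \det (sh (s * w)%g) = \det (sh w) * (1 + x).
  by rewrite shE det_add_rank1.
have rA : r *m invmx (sh w) = (1 + x) *: (r *m invmx (sh (s * w)%g)).
  rewrite -[LHS](mulmxK uA') {1}shE mulmxDr mulmxKV // mulmxA.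
  rewrite -(mulmxA r) [r *m (_ *m p)]mx11_scalar mul_scalar_mx -/x.
  by rewrite -{1}[r]scale1r -scalerDl -scalemxAl.
rewrite !det_shifted repM det_mulmx ds dA' gE /sol -!scalemxAl.
rewrite !(mulmxA r) rA -!scalemxAl; set y := r *m _.
rewrite !mxE; ring.
Qed.

Lemma euler_jacobi c0 c1 (Q : 'cV[R]_n -> R) :
    (forall w, regular (sl c0 w)) -> (forall w, regular (sl c1 w)) ->
    (forall w a g h, let z := sl c0 w + a *: sl c1 w in
        g != 1%g -> h != 1%g -> rW g *m z = z -> rW h *m z = z ->
      g = h /\ \rank (rW g - 1%:M) = 1%N) ->
    (forall z u, exists2 q : {poly R}, (size q <= D)%N &
       forall a, q.[a] = Q (z + a *: u)) ->
  \sum_w Q (sl c0 w) / (ev (sl c0 w) J * \det (1%:M - t *: rW w)) = 0.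
Proof.
move=> reg0 reg1 gen Qpoly.
pose Z w a := sl c0 w + a *: sl c1 w.
(* The Lagrange term of the root a for interpolation at 0; the last factor is 0 - a. *)
pose F w a := Q (Z w a) /
  (\det (1%:M - t *: rW w) * (grad f (Z w a) *m sl c1 w) 0 0 * - a).
have det0 w : \det (1%:M - t *: rW w) != 0 by apply: det_1Bt_neq0.
(* The reflection fixing [Z w a], or 1 if that point is regular. *)
pose sg w a := odflt 1%g [pick g | (g != 1%g) && (rW g *m Z w a == Z w a)].
have sg_fix w a : rW (sg w a) *m Z w a = Z w a.
  rewrite /sg; case: pickP => [g /andP[_ /eqP]|] //=.
  by rewrite rep1 mul1mx.
have sgN1 w a : ev (Z w a) J = 0 -> sg w a != 1%g.
  rewrite /sg; case: pickP => [g /andP[]|nog] //= Jz.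
  have : regular (Z w a).
    move=> g gz; apply/eqP; apply: contraFT (nog g) => g1.
    by rewrite g1 gz eqxx.
  by move/(jac_regular f_gen)/eqP; rewrite Jz.
have sg_uniq w a g : g != 1%g -> rW g *m Z w a = Z w a -> g = sg w a.
  move=> g1 gz; have s1 : sg w a != 1%g.
    rewrite /sg; case: pickP => [h /andP[]|/(_ g)] //=.
    by rewrite g1 gz eqxx.
  by have [] := gen w a g (sg w a) g1 s1 gz (sg_fix w a).
have sg_refl w a : sg w a != 1%g -> \rank (rW (sg w a) - 1%:M) = 1%N.
  by move=> s1; have [] := gen w a _ _ s1 s1 (sg_fix w a) (sg_fix w a).
have sg2 w a : (sg w a * sg w a = 1)%g.
  have [->|s1] := eqVneq (sg w a) 1%g; first by rewrite mulg1.
  have rk := sg_refl w a s1; have [c [r r0 SE]] := rank1_factor rk.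
  have sE : rW (sg w a) = 1%:M + c *m r by rewrite -SE addrC subrK.
  have [_ ss _] := reflection_props r0 rk sE.
  by apply: rW_inj; rewrite repM.
pose phi a w := (sg w a * w)%g.
(* A reflection s fixing z gives (s w)^-1 z = w^-1 z, so z solves the equations of both w and s w
   for the same parameter. *)
have Zphi a w : Z (phi a w) a = Z w a.
  have e : Z w a = sl (c0 + a *: c1) w by rewrite /Z /sol mulmxDr scalemxAr.
  have e' : Z (phi a w) a = sl (c0 + a *: c1) (phi a w).
    by rewrite /Z /sol mulmxDr scalemxAr.
  rewrite e'; apply/esym/(solP rW t01); rewrite /phi invMg repM -mulmxA.
  have -> : rW (sg w a)^-1%g *m Z w a = Z w a.
    by rewrite -{1}(sg_fix w a) mulmxA repVK mul1mx.
  exact/(solP rW t01).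
have sgphi a w : sg (phi a w) a = sg w a.
  by rewrite /sg; under eq_pick do rewrite Zphi.
have phiK a : involutive (phi a).
  by move=> w; rewrite {1}/phi sgphi /phi mulgA sg2 mul1g.
have Fphi a w : ev (Z w a) J = 0 -> F (phi a w) a = - F w a.
  move=> /sgN1/sg_refl rk; rewrite /F Zphi (residues_cancel w c1 rk (sg_fix w a)).
  by rewrite mulNr invrN mulrN.
have sumF0 a : \sum_(w | ev (Z w a) J == 0) F w a = 0.
  (* Reindexed by the involution [phi a], the sum is its own opposite. *)
  apply/eqP; rewrite -[_ == 0](@mulrn_eq0 _ _ 2) mulr2n {1}(reindex_inj (inv_inj (phiK a))) /=.
  rewrite (eq_bigl (fun w => ev (Z w a) J == 0)) => [|w]; last by rewrite Zphi.
  rewrite -big_split big1 //= => w /eqP Jz.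
  by rewrite Fphi // addNr.
have roots w : exists s : seq R, [/\ uniq s, forall a, (a \in s) = (ev (Z w a) J == 0),
    0 \notin s & Q (sl c0 w) / (ev (sl c0 w) J * \det (1%:M - t *: rW w)) =
                 \sum_(a <- s) F w a].
  have [s j0 jE] := line_jac_splits f_gen (sl c0 w) (reg1 w).
  have [szj _] := line_jac_lead f_gen f_hom (sl c0 w) (reg1 w).
  set j := line _ _ J in j0 jE szj.
  have lc0 : lead_coef j != 0 by rewrite lead_coef_eq0.
  have sP a : (a \in s) = (ev (Z w a) J == 0).
    by rewrite -line_horner -/j jE hornerZ mulf_eq0 (negPf lc0) /= -rootE root_prod_XsubC.
  have us : uniq s.
    apply: uniq_simple_roots => a; rewrite sP => /eqP Jz.
    have s1 := sgN1 _ _ Jz; have rk := sg_refl w a s1.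
    have := @jac_simple_zero R n W rW f f_inv f_gen (sg w a) (Z w a) (sl c1 w)
      (sg_fix w a) rk.
    have su : rW (sg w a) *m sl c1 w <> sl c1 w.
      by move/reg1/eqP; apply/negP.
    move=> /(_ su); rewrite -line_jac_deriv -/j jE derivZ hornerZ mulf_eq0.
    move=> h; have /h : forall g, rW g *m Z w a = Z w a -> g = 1%g \/ g = sg w a.
      move=> g gz; have [->|g1] := eqVneq g 1%g; [by left|right].
      exact: sg_uniq.
    by case/norP.
  have s0 : 0 \notin s.
    by rewrite sP /Z scale0r addr0 (jac_regular f_gen (reg0 w)).
  exists s; split=> //.
  have [q sq qE] := Qpoly (sl c0 w) (sl c1 w).
  have szs : size s = D.
    have : size j = (size s).+1 by rewrite jE size_scale // size_prod_XsubC.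
    by rewrite szj => -[].
  have := lagrange_residues lc0 us jE _ s0; rewrite -[size s]/(size s) => /(_ q).
  rewrite szs => /(_ sq); rewrite qE scale0r addr0 line_at0 invfM mulrA => ->.
  rewrite mulr_suml; apply: eq_bigr => a _.
  by rewrite qE line_jac_deriv /F sub0r !invfM; ring.
have [s sP] := fin_all_exists roots.
rewrite (eq_bigr (fun w => \sum_(a <- s w) F w a)); last first.
  by move=> w _; have [] := sP w.
(* A list of roots common to all w, so that the sums over w and over a can be exchanged. *)
pose T := undup (flatten [seq s w | w <- index_enum W]).
rewrite (eq_bigr (fun w => \sum_(a <- T | ev (Z w a) J == 0) F w a)); last first.
  move=> w _; rewrite -[RHS]big_filter; have [us sE _ _] := sP w.
  apply: perm_big; apply: uniq_perm; rewrite ?filter_uniq ?undup_uniq //.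
  move=> a; rewrite mem_filter mem_undup -sE; case: (boolP (a \in s w)) => //= aw.
  apply/esym/flattenP; exists (s w) => //; apply: map_f.
  exact: mem_index_enum.
rewrite (exchange_big_dep predT) //= big1 // => a _.
Qed.

Lemma ev_homog d (p : {mpoly R[n]}) a u :
  p \is d.-homog -> ev (a *: u) p = a ^+ d * ev u p.
Proof.
move=> /dhomogP hp; rewrite /ev !mevalE mulr_sumr big_seq [RHS]big_seq.
apply: eq_bigr => k /hp dk; have <- : mdeg k = d by [].
rewrite mulrCA mdegE -prodrXr -big_split; congr (_ * _).
by apply: eq_bigr => i _; rewrite mxE exprMn.
Qed.

Lemma molien_solomon y :
  \prod_i (1 - t ^+ (m i).+1) *
    (\sum_w \det (1%:M + y *: rW w) / \det (1%:M - t *: rW w)) =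
  #|W|%:R * \prod_i (1 + y * t ^+ m i).
Proof.
have [c0 [c1 [reg0 reg1 gen]]] := exists_generic_lines rW_inj t01.
set a := \prod_i _; set b := \prod_i (1 + _).
pose H y' z := \det (df f z + y' *: df f (t *: z + c0)).
(* Along u the coefficient of degree D is b J(u) in [H y] and a J(u) in [H (- t)], so it cancels in
   [Q]. *)
pose Q z := a * H y z - b * H (- t) z.
have Hpoly y' z u : exists q : {poly R}, [/\ (size q <= D.+1)%N,
    q`_D = \prod_i (1 + y' * t ^+ m i) * ev u J & forall x, q.[x] = H y' (z + x *: u)].
  pose M : 'M[{poly R}]_n := \matrix_(i, j) (line z u (tnth f i)^`M(j) +
    y' *: line (t *: z + c0) (t *: u) (tnth f i)^`M(j)).
  have hom i j : (tnth f i)^`M(j) \is (m i).-homog by apply: dhomog_mderiv.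
  have szM i j : (size (M i j) <= (m i).+1)%N.
    rewrite mxE (leq_trans (size_polyD _ _)) // geq_max (line_homog _ _ (hom i j)).1.
    by rewrite (leq_trans (size_scale_leq _ _)) // (line_homog _ _ (hom i j)).1.
  exists (\det M); have [s1 s2] := det_poly_coef szM; split=> //.
    rewrite s2 ev_jac (_ : \matrix_(i, j) _ =
      diag_mx (\row_i (1 + y' * t ^+ m i)) *m df f u).
      by rewrite det_mulmx det_diag; congr (_ * _); apply: eq_bigr => i _; rewrite mxE.
    apply/matrixP => i j; rewrite mul_diag_mx !mxE coefD coefZ.
    rewrite !(line_homog _ _ (hom i j)).2 (ev_homog _ _ (hom i j)); ring.
  move=> x; rewrite -horner_evalE -det_map_mx; congr (\det _).
  apply/matrixP => i j; rewrite !mxE /= horner_evalE hornerD hornerZ !line_horner.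
  by rewrite scalerDr !scalerA -addrA [c0 + _]addrC addrA [x * t]mulrC.
have Qpoly z u : exists2 q : {poly R}, (size q <= D)%N &
    forall x, q.[x] = Q (z + x *: u).
  have [q1 [s1 l1 e1]] := Hpoly y z u; have [q2 [s2 l2 e2]] := Hpoly (- t) z u.
  exists (a *: q1 - b *: q2) => [|x]; last by rewrite !hornerE e1 e2.
  apply/leq_sizeP => k; rewrite leq_eqVlt => /orP[/eqP <-|Dk].
    rewrite coefB !coefZ l1 l2 -/b (_ : \prod_i (1 + - t * t ^+ m i) = a); first by ring.
    by apply: eq_bigr => i _; rewrite mulNr -exprS.
  by rewrite coefB !coefZ !nth_default ?mulr0 ?subrr ?(leq_trans s1) ?(leq_trans s2).
have := euler_jacobi reg0 reg1 gen Qpoly.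
have HE w y' : H y' (sl c0 w) = ev (sl c0 w) J * \det (1%:M + y' *: rW w).
  rewrite /H -(solP rW t01 c0 w (sl c0 w)).2 //.
  have -> : df f (rW w^-1%g *m sl c0 w) = df f (sl c0 w) *m rW w.
    by rewrite -(df_act f_inv w) mulmxA repKV mul1mx.
  by rewrite ev_jac -det_mulmx mulmxDr mulmx1 scalemxAr.
rewrite (eq_bigr (fun w => a * (\det (1%:M + y *: rW w) / \det (1%:M - t *: rW w)) - b)).
  rewrite sumrB -mulr_sumr sumr_const => /eqP; rewrite subr_eq0 => /eqP ->.
  by rewrite mulr_natl.
move=> w _; rewrite /Q !HE scaleNr.
have J0 := jac_regular f_gen (reg0 w); have d0 := det_1Bt_neq0 rW w t01.
by field; rewrite J0 d0.
Qed.
End Solomon.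

(** * Passage to t = 1 *)

Section SolomonFormula.
Variables (R : realFieldType) (n : nat) (W : finGroupType).
Variable rW : mx_representation R [set: W]%G n.
Variables (f : n.-tuple {mpoly R[n]}) (m : 'I_n -> nat).
Hypothesis f_inv : forall i, rep_invariant rW (tnth f i).
Hypothesis f_gen :
  forall p, rep_invariant rW p -> exists g : {mpoly R[n]}, p = g \mPo f.
Hypothesis f_hom : forall i, tnth f i \is (m i).+1.-homog.
Hypothesis rW_inj : forall g, rW g = 1%:M -> g = 1%g.

Let k w := \rank (fixproj rW w).

(** With y = x (1 - t) - 1, the factors for Fix w contribute x^(dim Fix w), and (1 - t)^n cancels on
    both sides. Once the denominators [Sn u] are cleared, a polynomial identity in t holds on (0,
    1), hence also at 1. There (1 - t^d) / (1 - t) becomes d, whence the factors m_i + 1. *)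
Lemma sum_pow_rank_fix_scaled x :
  \prod_i (m i).+1%:R * (\sum_w x ^+ k w) = #|W|%:R * \prod_i (x + (m i)%:R) :> R.
Proof.
pose M w := rW w *m (1%:M - fixproj rW w).
pose S w : {poly R} := \det (1%:M + 'X *: map_mx polyC (M w)).
have SE w y : (S w).[y] = \det (1%:M + y *: M w).
  rewrite -horner_evalE -det_map_mx; congr (\det _).
  apply/matrixP => i j; rewrite !mxE /= horner_evalE hornerD hornerM hornerX hornerC.
  by case: (i == j); rewrite ?hornerC.
pose Sn w := S w \Po (- 'X); pose Sy w := S w \Po (x *: (1 - 'X) - 1).
pose g d : {poly R} := \sum_(i < d) 'X^i.
have gE d (t : R) : 1 - t ^+ d = (1 - t) * (g d).[t].
  rewrite -[1 - _]opprB -[1 - t]opprB subrX1 mulNr horner_sum; congr (- (_ * _)).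
  by apply: eq_bigr => i _; rewrite hornerXn.
have key : (\prod_i g (m i).+1) * \sum_w (x ^+ k w *: (Sy w * \prod_(u | u != w) Sn u)) =
    #|W|%:R *: ((\prod_u Sn u) * \prod_i (g (m i) + x *: 'X^(m i))).
  apply: poly_eq_interval => t t01.
  have t1 : 1 - t != 0 by rewrite subr_eq0 eq_sym lt_eqF //; case/andP: t01.
  have := molien_solomon f_inv f_gen f_hom rW_inj t01 (x * (1 - t) - 1).
  have SnE w : (Sn w).[t] = \det (1%:M + (- t) *: M w).
    by rewrite horner_comp SE hornerN hornerX.
  have detE w : \det (1%:M - t *: rW w) = (1 - t) ^+ k w * (Sn w).[t].
    by rewrite SnE -det_rep scaleNr.
  have SyE w : (Sy w).[t] = \det (1%:M + (x * (1 - t) - 1) *: M w).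
    by rewrite horner_comp SE !hornerE.
  have Sn0 w : (Sn w).[t] != 0.
    by have := det_1Bt_neq0 rW w t01; rewrite detE mulf_eq0 => /norP[].
  under eq_bigr => i _ do rewrite gE.
  rewrite big_split /= prodr_const card_ord.
  rewrite (eq_bigr (fun w => x ^+ k w * ((Sy w).[t] / (Sn w).[t]))); last first.
    move=> w _; rewrite detE det_rep -SyE -/(k w).
    have tk : (1 - t) ^+ k w != 0 by rewrite expf_neq0.
    rewrite addrC subrK exprMn; move: (Sn0 w) tk.
    move: (Sn w).[t] (Sy w).[t] ((1 - t) ^+ k w) (x ^+ k w) => p q r s p0 r0.
    by field; rewrite p0.
  rewrite [X in _ = _ * X](eq_bigr (fun i => (1 - t) * (g (m i) + x *: 'X^(m i)).[t])); last first.
    by move=> i _; rewrite hornerD hornerZ hornerXn [in RHS]mulrDr -gE; ring.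
  rewrite big_split /= prodr_const card_ord mulrCA -mulrA.
  move=> /(mulfI (expf_neq0 _ t1)) e.
  rewrite hornerZ !hornerM !horner_prod horner_sum [RHS]mulrCA -e [RHS]mulrCA.
  congr (_ * _).
  rewrite mulr_sumr; apply: eq_bigr => w _.
  rewrite hornerZ hornerM horner_prod [in RHS](bigD1 w) //=.
  rewrite [RHS]mulrC -!mulrA; congr (_ * (_ * _)).
  by rewrite mulKf.
have := congr1 (fun p : {poly R} => p.[1]) key.
rewrite hornerZ !hornerM !horner_prod horner_sum.
have g1 d : (g d).[1] = d%:R.
  rewrite horner_sum (eq_bigr (fun=> 1)) ?sumr_const ?card_ord // => i _.
  by rewrite hornerXn expr1n.
have Sn1 w : (Sn w).[1] = (S w).[- 1] by rewrite horner_comp !hornerE.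
have Sy1 w : (Sy w).[1] = (S w).[- 1].
  by rewrite horner_comp !hornerE subrr mulr0 add0r.
have S0 w : (S w).[- 1] != 0.
  by rewrite SE scaleN1r det_fixproj_neq0.
under eq_bigr => i _ do rewrite g1.
rewrite (eq_bigr (fun w => \prod_u (S u).[-1] * x ^+ k w)); last first.
  move=> w _; rewrite hornerZ hornerM horner_prod Sy1 mulrC; congr (_ * _).
  rewrite [RHS](bigD1 w) //=; congr (_ * _); apply: eq_bigr => u _.
  exact: Sn1.
rewrite -mulr_sumr mulrCA => e.
have P0 : \prod_u (S u).[-1] != 0 by apply/prodf_neq0 => u _; apply: S0.
apply: (mulfI P0); rewrite e mulrCA; congr (_ * (_ * _)).
  by apply: eq_bigr => u _.
by apply: eq_bigr => i _; rewrite !hornerE g1 expr1n mulr1 addrC.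
Qed.

(** The coefficients of x^n in the scaled identity give |W| as the product of the m_i + 1, since
    only the identity fixes the whole space. *)
Theorem sum_pow_rank_fix x : \sum_w x ^+ k w = \prod_i (x + (m i)%:R) :> R.
Proof.
have eqp : \prod_i (m i).+1%:R *: (\sum_w 'X^(k w)) =
    #|W|%:R *: \prod_i ('X - (- (m i)%:R)%:P) :> {poly R}.
  apply: poly_eq_nat => j; rewrite !hornerZ horner_sum horner_prod.
  rewrite (eq_bigr (fun w => j%:R ^+ k w)) => [|w _]; last by rewrite hornerXn.
  rewrite sum_pow_rank_fix_scaled; congr (_ * _).
  by apply: eq_bigr => i _; rewrite hornerXsubC opprK.
have lead : \prod_i (m i).+1%:R = #|W|%:R :> R.
  have := congr1 (fun p : {poly R} => p`_n) eqp; rewrite /= !coefZ.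
  have -> : (\prod_i ('X - (- (m i)%:R)%:P))`_n = 1 :> R.
    rewrite -big_enum /= -[RHS](monicP (monic_prod_XsubC (enum 'I_n) predT
      (fun i => - (m i)%:R))) lead_coefE size_prod_XsubC.
    by rewrite size_enum_ord.
  rewrite coef_sum (bigD1 1%g) //= [X in _ + X]big1 => [|w w1].
    have -> : k 1%g = n by rewrite /k rank_fixproj rep1 subrr mxrank0 subn0.
    by rewrite coefXn eqxx addr0 !mulr1.
  rewrite coefXn; case: eqP => // kn; case/negP: w1; apply/eqP/rW_inj.
  apply/eqP; rewrite -subr_eq0 -mxrank_eq0; apply/eqP.
  have := rank_fixproj rW w; rewrite -/(k w) -kn.
  by have := rank_leq_row (rW w - 1%:M); move: (\rank _) => r; lia.
have W0 : #|W|%:R != 0 :> R by rewrite pnatr_eq0 -lt0n; apply/card_gt0P; exists 1%g.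
by apply: (mulfI W0); rewrite -{1}lead sum_pow_rank_fix_scaled.
Qed.
End SolomonFormula.

(** * Faces of the Coxeter complex *)

Section Coxeter.
Variables (R : realType) (n : nat) (W : finGroupType) (C : coxeter_data R n W).
Implicit Types (i j k : 'I_n) (g h w : W) (u v : 'cV[R]_n) (J K L : {set 'I_n}).

Local Notation B := (cx_gram C).
Local Notation rW := (cx_rep C).
Local Notation s_ := (cx_gen C).
Local Notation Phi := (cx_root C).
Local Notation alpha := (tnth (cx_simple C)).
Local Notation ip := (inner (cx_gram C)).
Local Notation pos := (nonneg_comb (cx_simple C)).
Local Notation neg := (negative_root C).
Local Notation co i := (coord (cx_simple C) i).

Lemma ipDr u v v' : ip u (v + v') = ip u v + ip u v'.
Proof. by rewrite /inner mulmxDr mxE. Qed.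
Lemma ipZr a u v : ip u (a *: v) = a * ip u v.
Proof. by rewrite /inner -!scalemxAr mxE. Qed.
Lemma ip_sumr I r (P : pred I) u (F : I -> 'cV[R]_n) :
  ip u (\sum_(i <- r | P i) F i) = \sum_(i <- r | P i) ip u (F i).
Proof. by rewrite /inner mulmx_sumr summxE. Qed.
Lemma ipNr u v : ip u (- v) = - ip u v.
Proof. by rewrite -scaleN1r ipZr mulN1r. Qed.
Lemma ipBr u v v' : ip u (v - v') = ip u v - ip u v'.
Proof. by rewrite ipDr ipNr. Qed.
Lemma ipC u v : ip u v = ip v u.
Proof.
have [Bt _] := cx_inner C; rewrite /inner.
suff -> : u^T *m B *m v = (v^T *m B *m u)^T by rewrite mxE.
by rewrite !trmx_mul trmxK Bt mulmxA.
Qed.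
Lemma ip_gt0 v : v != 0 -> 0 < ip v v.
Proof. by have [_ h] := cx_inner C; apply: h. Qed.

Lemma alpha_free : free (cx_simple C).
Proof. by have [/basis_free] := cx_simpleP C. Qed.

Lemma alpha_root i : alpha i \in Phi.
Proof. by have [_ h _] := cx_simpleP C; apply/h/mem_tnth. Qed.

Lemma root_neq0 v : v \in Phi -> v != 0.
Proof. by have [h _ _] := cx_rootP C; apply: contraTneq => ->. Qed.

Lemma co_alpha i j : co i (alpha j) = (i == j)%:R.
Proof. by rewrite (tnth_nth 0) coord_free ?alpha_free // eq_sym. Qed.

Lemma coN i v : co i (- v) = - co i v.
Proof. exact: raddfN. Qed.

Lemma co_sum v : v = \sum_i co i v *: alpha i.
Proof.
have [hb _ _] := cx_simpleP C; rewrite {1}(coord_basis hb (memvf v)).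
by apply: eq_bigr => i _; rewrite (tnth_nth 0).
Qed.

Lemma co_eq0 v : (forall i, co i v = 0) -> v = 0.
Proof.
by move=> h; rewrite [v]co_sum big1 // => i _; rewrite h scale0r.
Qed.

Lemma posP v : reflect (forall i, 0 <= co i v) (pos v).
Proof. exact: forallP. Qed.

Lemma pos_alpha i : pos (alpha i).
Proof. by apply/posP => k; rewrite co_alpha ler0n. Qed.

Lemma root_pm v : v \in Phi -> pos v || pos (- v).
Proof. by have [_ _ h] := cx_simpleP C; apply: h. Qed.

Lemma pos_neg0 v : pos v -> pos (- v) -> v = 0.
Proof.
move=> /posP h /posP h'; apply: co_eq0 => i; apply/eqP; rewrite eq_le h andbT.
by have := h' i; rewrite coN oppr_ge0.
Qed.

Lemma root_opp v : v \in Phi -> - v \in Phi.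
Proof.
have [_ h _] := cx_rootP C; move=> vP.
by rewrite -scaleN1r h // eqxx orbT.
Qed.

Lemma negE v : v \in Phi -> neg v = ~~ pos v.
Proof.
move=> vP; rewrite /negative_root vP /=; apply/idP/idP => [pn|].
  apply/negP => pv; have := root_neq0 vP.
  by rewrite (pos_neg0 pv pn) eqxx.
by have := root_pm vP; case: (pos v).
Qed.

Lemma gen_act i v :
  rW (s_ i) *m v = v - (2 * ip v (alpha i) / ip (alpha i) (alpha i)) *: alpha i.
Proof. exact: cx_genE. Qed.

Lemma alpha_sq_gt0 i : 0 < ip (alpha i) (alpha i).
Proof. exact/ip_gt0/root_neq0/alpha_root. Qed.

Lemma gen_alpha i : rW (s_ i) *m alpha i = - alpha i.
Proof.
rewrite gen_act mulfK ?lt0r_neq0 ?alpha_sq_gt0 // scaler_nat mulr2n opprD addrA.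
by rewrite subrr add0r.
Qed.

Lemma gen_fix i v : ip v (alpha i) = 0 -> rW (s_ i) *m v = v.
Proof. by move=> h; rewrite gen_act h mulr0 mul0r scale0r subr0. Qed.

Lemma ip_gen i u v : ip (rW (s_ i) *m u) (rW (s_ i) *m v) = ip u v.
Proof.
rewrite !gen_act !ipBr !ipZr ![ip (_ - _) _]ipC !ipBr !ipZr.
have := lt0r_neq0 (alpha_sq_gt0 i); rewrite ?(ipC (alpha i) v) ?(ipC (alpha i) u) ?(ipC v u).
by move=> h; field.
Qed.

Lemma co_gen i k v : k != i -> co k (rW (s_ i) *m v) = co k v.
Proof.
move=> ki; rewrite gen_act raddfB /= linearZ /= co_alpha (negPf ki).
by rewrite mulr0 subr0.
Qed.

Definition word (t : seq 'I_n) : W := (\prod_(i <- t) s_ i)%g.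

Definition parabolic J : {group W} := <<[set s_ i | i in J]>>%G.

Lemma parabolicP J w :
  reflect (exists2 t, {subset t <= J} & w = word t) (w \in parabolic J).
Proof.
apply: (iffP idP) => [/gen_prodgP[l [c cJ ->]]|[t tJ ->]]; last first.
  rewrite /word big_seq; apply: group_prod => i /tJ iJ.
  by apply/mem_gen/imset_f.
elim: l c cJ => [|l IH] c cJ; first by exists [::]; rewrite // /word big_nil big_ord0.
rewrite big_ord_recl; have /imsetP[i iJ ->] := cJ ord0.
have [|t tJ ->] := IH (fun x => c (lift ord0 x)); first by move=> x; apply: cJ.
exists (i :: t); last by rewrite /word big_cons.
by move=> k; rewrite inE => /orP[/eqP->|/tJ].
Qed.

Lemma parabolicT w : w \in parabolic setT.
Proof.
have [_ _ gen _] := cx_system C.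
suff -> : parabolic setT = [set: W]%G by rewrite inE.
apply: val_inj; rewrite /= -gen; congr generated.
by apply/setP => x; apply/imsetP/imsetP => -[i _ ->]; exists i; rewrite ?inE.
Qed.

Lemma gen_parabolic J i : i \in J -> s_ i \in parabolic J.
Proof. by move=> iJ; apply/mem_gen/imset_f. Qed.

Lemma word_ind (P : W -> Prop) :
  P 1%g -> (forall i w, P w -> P (s_ i * w)%g) -> forall w, P w.
Proof.
move=> P1 PM w; have /parabolicP[t _ ->] := parabolicT w.
by elim: t => [|i t IH]; rewrite /word ?big_nil // big_cons; apply: PM.
Qed.

Lemma ip_act w u v : ip (rW w *m u) (rW w *m v) = ip u v.
Proof.
elim/word_ind: w => [|i w IH]; first by rewrite rep1 !mul1mx.
by rewrite repM -!mulmxA ip_gen.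
Qed.

Lemma ip_actV w u v : ip (rW w *m u) v = ip u (rW w^-1%g *m v).
Proof. by rewrite -(ip_act w u) mulmxA repKV mul1mx. Qed.

Lemma root_act w v : v \in Phi -> rW w *m v \in Phi.
Proof.
move=> vP; elim/word_ind: w => [|i w IH]; first by rewrite rep1 mul1mx.
rewrite repM -mulmxA cx_genE.
by have [_ _ h] := cx_rootP C; apply: h => //; apply: alpha_root.
Qed.

Lemma rep_inj : forall g, rW g = 1%:M -> g = 1%g.
Proof.
move=> g e; apply: (mx_faithful_inj (cx_faithful C)); rewrite ?inE //.
by rewrite e rep1.
Qed.

(** The generator changes only the coefficient of [alpha i]. If the image were negative, all other
    coefficients of v would vanish, and the only positive root proportional to [alpha i] is
    itself. *)
Lemma gen_pos i v : v \in Phi -> pos v -> v != alpha i -> pos (rW (s_ i) *m v).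
Proof.
move=> vP pv va; have := root_pm (root_act (s_ i) vP).
case/orP => // /posP pn.
suff e : v = co i v *: alpha i.
  have [_ h _] := cx_rootP C; move: (vP); rewrite e h ?alpha_root //.
  case/orP => /eqP c1; first by rewrite e c1 scale1r eqxx in va.
  by move/posP: pv => /(_ i); rewrite c1 oppr_ge0 ler10.
rewrite {1}[v]co_sum (bigD1 i) //= big1 ?addr0 // => k ki.
rewrite (_ : co k v = 0) ?scale0r //; apply/eqP; rewrite eq_le.
by have /posP-> := pv; have := pn k; rewrite coN co_gen // oppr_ge0 => ->.
Qed.

Lemma gen_conj w i j : rW w *m alpha j = alpha i -> (w * s_ j = s_ i * w)%g.
Proof.
move=> e; apply: (mx_faithful_inj (cx_faithful C)); rewrite ?inE // !repM.
apply/matrixP => a b; rewrite -[_ *m _]mulmx1 -[in RHS](mulmx1 (rW _ *m _)).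
have vE (X : 'M[R]_n) : (X *m 1%:M) a b = (X *m col b 1%:M) a 0.
  by rewrite colE mulmxA -colE [RHS]mxE.
rewrite !vE -!mulmxA; congr (_ a 0); move: (col b _) => v.
rewrite !gen_act mulmxBr -scalemxAr e.
by rewrite -e !ip_act.
Qed.

(** The exchange condition: applying the letters from the right, the letter i that first makes the
    root negative must meet it at [alpha i]; then the tail conjugates [s_ j] to [s_ i], and this
    letter can be deleted. *)
Lemma exchange t j : neg (rW (word t) *m alpha j) ->
  exists2 t', (size t' < size t)%N /\ {subset t' <= t} & (word t * s_ j)%g = word t'.
Proof.
elim: t => [|i t IH].
  by rewrite /word big_nil rep1 mul1mx negE ?alpha_root // pos_alpha.
have wE l : word (i :: l) = (s_ i * word l)%g by rewrite /word big_cons.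
rewrite wE repM -mulmxA => h.
have [h'|h'] := boolP (neg (rW (word t) *m alpha j)).
  have [t' [st tt'] e] := IH h'; exists (i :: t'); last by rewrite !wE -e mulgA.
  split=> // k; rewrite !inE => /orP[->//|/tt' ->]; exact: orbT.
have tr : rW (word t) *m alpha j \in Phi by rewrite root_act ?alpha_root.
rewrite negE // negbK in h'.
have [e|ne] := eqVneq (rW (word t) *m alpha j) (alpha i).
  exists t; first by split=> // k kt; rewrite inE kt orbT.
  have ss : (s_ i * s_ i)%g = 1%g.
    by have [_ h2 _ _] := cx_system C; rewrite -[RHS](expg_order (s_ i)) h2 expgS expg1.
  by rewrite -mulgA (gen_conj e) mulgA ss mul1g.
by move: h; rewrite negE ?root_act ?alpha_root // gen_pos.
Qed.

(** If the last letter of a word is not a descent, the exchange condition yields a shorter word in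
    letters of the same set. *)
Lemma parabolic_descent J w : w \in parabolic J -> w != 1%g ->
  exists2 j, j \in J & neg (rW w *m alpha j).
Proof.
case/parabolicP=> t; have [l] := ubnP (size t).
elim: l => // l IH in t w *; rewrite ltnS => tl tJ -> {w}.
case/lastP: t => [|t j] in tl tJ *; first by rewrite /word big_nil eqxx.
have wE : word (rcons t j) = (word t * s_ j)%g.
  by rewrite /word -cats1 big_cat big_seq1.
move: tl; rewrite size_rcons => tl.
have jJ : j \in J by apply: tJ; rewrite mem_rcons mem_head.
rewrite wE => w1.
have [h|h] := boolP (neg (rW (word t * s_ j)%g *m alpha j)); first by exists j.
have [|t' [st tt'] e] := @exchange t j.
  move: h; rewrite repM -mulmxA gen_alpha mulmxN.
  have tr : rW (word t) *m alpha j \in Phi by rewrite root_act ?alpha_root.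
  rewrite negE ?root_opp // negbK => h; rewrite /negative_root tr /=.
  exact: h.
rewrite e in w1 *; apply: (IH t') => //; first exact: leq_trans st (ltnW tl).
by move=> k /tt' kt; apply: tJ; rewrite mem_rcons inE kt orbT.
Qed.
End Coxeter.

(** * Dominant points and their stabilizers *)

Section Faces.
Variables (R : realType) (n : nat) (W : finGroupType) (C : coxeter_data R n W).
Implicit Types (i j k : 'I_n) (g h u w : W) (v : 'cV[R]_n) (J K L : {set 'I_n}).

Local Notation B := (cx_gram C).
Local Notation rW := (cx_rep C).
Local Notation s_ := (cx_gen C).
Local Notation Phi := (cx_root C).
Local Notation alpha := (tnth (cx_simple C)).
Local Notation ip := (inner (cx_gram C)).
Local Notation pos := (nonneg_comb (cx_simple C)).
Local Notation neg := (negative_root C).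
Local Notation co i := (coord (cx_simple C) i).
Local Notation parabolic := (parabolic C).

Definition simple_forms : 'M[R]_n := \matrix_(i, j) ((alpha i)^T *m B) 0 j.

Lemma simple_formsE v i : (simple_forms *m v) i 0 = ip (alpha i) v.
Proof.
by rewrite /inner [LHS]mxE [RHS]mxE; apply: eq_bigr => j _; rewrite mxE.
Qed.

Lemma sub_of_ker m1 m2 (A : 'M[R]_(m1, n)) (D : 'M[R]_(m2, n)) :
  (forall v, D *m v = 0 -> A *m v = 0) -> (A <= D)%MS.
Proof.
move=> h; rewrite submxE; apply/eqP/matrixP => i j; rewrite [RHS]mxE.
have e m (X : 'M[R]_(m, n)) : X *m col j (cokermx D) = col j (X *m cokermx D).
  by rewrite !colE mulmxA.
have := h (col j (cokermx D)); rewrite !e mulmx_coker col0 => /(_ erefl)/colP/(_ i).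
by rewrite [in RHS]mxE [LHS]mxE.
Qed.

Lemma ker_of_sub m1 m2 (A : 'M[R]_(m1, n)) (D : 'M[R]_(m2, n)) v :
  (A <= D)%MS -> D *m v = 0 -> A *m v = 0.
Proof. by case/submxP=> X ->; rewrite -mulmxA => ->; rewrite mulmx0. Qed.

Lemma simple_forms_unit : simple_forms \in unitmx.
Proof.
rewrite -row_full_unit -sub1mx; apply: sub_of_ker => v h; rewrite mul1mx.
apply/eqP; apply: contraT => v0; have := ip_gt0 C v0.
rewrite {2}(co_sum C v) ip_sumr big1 ?ltxx // => i _.
by rewrite ipZr ipC -simple_formsE h mxE mulr0.
Qed.

(** A sum of fundamental weights, suitably scaled: an interior point of the face C_L of the dominant
    chamber, used to represent that face. *)
Definition rho L : 'cV[R]_n := invmx simple_forms *m \col_i (i \notin L)%:R.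

Lemma ip_rho L i : ip (rho L) (alpha i) = (i \notin L)%:R.
Proof. by rewrite ipC -simple_formsE mulKVmx ?simple_forms_unit // mxE. Qed.

Lemma ip_rho_sum L v : ip (rho L) v = \sum_(i | i \notin L) co i v.
Proof.
rewrite {1}(co_sum C v) ip_sumr [RHS]big_mkcond; apply: eq_bigr => i _.
by rewrite ipZr ip_rho; case: ifP; rewrite ?mulr1 ?mulr0.
Qed.

(** The pairing is the sum of the coefficients outside [L], which for a root all have the same
    sign. *)
Lemma rho_root_eq0 L v : v \in Phi -> ip (rho L) v = 0 ->
  forall i, i \notin L -> co i v = 0.
Proof.
move=> vP; wlog pv : v vP / pos v => [hw|].
  case/orP: (root_pm vP) => [|pv e i iL]; first exact: hw.
  apply/eqP; rewrite -oppr_eq0 -coN; apply/eqP; apply: hw (iL) => //.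
    exact: root_opp.
  by rewrite ipNr e oppr0.
rewrite ip_rho_sum => /eqP; rewrite psumr_eq0 => [/allP h i iL|i _]; last exact/posP.
by have := h i (mem_index_enum _); rewrite iL => /eqP.
Qed.

Lemma rho_pos_ge0 L v : pos v -> 0 <= ip (rho L) v.
Proof. by move=> /posP pv; rewrite ip_rho_sum sumr_ge0. Qed.

Definition dominant J v := [forall j in J, 0 <= ip v (alpha j)].
Definition zeros J v := [set j in J | ip v (alpha j) == 0].

Lemma dominantP J v : reflect (forall j, j \in J -> 0 <= ip v (alpha j)) (dominant J v).
Proof. exact: forall_inP. Qed.

Lemma dominant_rho J L : dominant J (rho L).
Proof. by apply/dominantP => j _; rewrite ip_rho ler0n. Qed.

Lemma zeros_rho L : zeros setT (rho L) = L.
Proof.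
by apply/setP => i; rewrite !inE ip_rho pnatr_eq0 eqb0 negbK.
Qed.

(** Take h in W_J maximizing the pairing with an interior point of the chamber; a negative pairing
    of h v with [alpha j] would let s_j increase it. *)
Lemma dominant_conj J v : exists2 h, h \in parabolic J & dominant J (rW h *m v).
Proof.
pose F h := ip (rW h *m v) (rho set0).
have [h hJ hmax] := @arg_maxP _ R W 1%g (fun h => h \in parabolic J) F (group1 _).
exists h => //; apply/dominantP => j jJ; rewrite leNgt; apply/negP => hj.
have := hmax (s_ j * h)%g; rewrite groupM ?gen_parabolic // => /(_ isT).
apply/negP; rewrite -ltNge /F repM -mulmxA gen_act ipC [ip _ (rho _)]ipC ipBr ipZr.
rewrite ip_rho inE mulr1 ltrBrDr gtrDl pmulr_llt0.
  by rewrite pmulr_rlt0 // ltr0n.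
by rewrite invr_gt0 alpha_sq_gt0.
Qed.

Lemma co_parabolic J w k v : w \in parabolic J -> k \notin J ->
  co k (rW w *m v) = co k v.
Proof.
case/parabolicP=> t tJ -> kJ; elim: t tJ => [|i t IH] tJ.
  by rewrite /word big_nil rep1 mul1mx.
rewrite /word big_cons repM -mulmxA co_gen.
  by apply: IH => l lt; apply: tJ; rewrite inE lt orbT.
by apply: contraNneq kJ => ->; apply: tJ; rewrite mem_head.
Qed.

Lemma parabolic_fix K w v : w \in parabolic K ->
  (forall k, k \in K -> ip v (alpha k) = 0) -> rW w *m v = v.
Proof.
case/parabolicP=> t tK -> h; elim: t tK => [|i t IH] tK.
  by rewrite /word big_nil rep1 mul1mx.
rewrite /word big_cons repM -mulmxA IH; last first.
  by move=> l lt; apply: tK; rewrite inE lt orbT.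
by rewrite gen_fix ?h ?tK ?mem_head.
Qed.

Lemma parabolicS J K : K \subset J -> parabolic K \subset parabolic J.
Proof. by move=> KJ; apply: genS; apply: imsetS. Qed.

Lemma dominant_neg_le0 J w v j : w \in parabolic J -> j \in J ->
  dominant J v -> neg (rW w *m alpha j) -> ip v (rW w *m alpha j) <= 0.
Proof.
move=> wJ jJ /dominantP dv /andP[_ /posP nw].
rewrite (co_sum C (rW w *m alpha j)) ip_sumr sumr_le0 // => i _; rewrite ipZr.
have [iJ|iJ] := boolP (i \in J).
  by apply: mulr_le0_ge0; [have := nw i; rewrite coN oppr_ge0 | apply: dv].
rewrite (co_parabolic _ wJ iJ) co_alpha.
by case: eqP iJ => [->|_]; rewrite ?jJ ?mul0r.
Qed.

(** For a descent j of w, <v, alpha_j> = <w v, w alpha_j> is both nonnegative and nonpositive. So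
    s_j fixes v, and w s_j is a shorter element to which induction applies. *)
Lemma parabolic_dominant J w v : w \in parabolic J ->
  dominant J v -> dominant J (rW w *m v) -> w \in parabolic (zeros J v).
Proof.
case/parabolicP=> t; have [l] := ubnP (size t).
elim: l => // l IH in t w *; rewrite ltnS => tl tJ wE dv dw.
have wJ : w \in parabolic J by apply/parabolicP; exists t.
have [->|w1] := eqVneq w 1%g; first exact: group1.
have [j jJ nj] := parabolic_descent wJ w1.
have vj : ip v (alpha j) = 0.
  apply/eqP; rewrite eq_le (dominantP _ _ dv) // andbT.
  by rewrite -(ip_act C w) (dominant_neg_le0 wJ jJ dw nj).
have [t' [st tt'] e] := @exchange _ _ _ C t j ltac:(by rewrite -wE).
have jz : s_ j \in parabolic (zeros J v) by rewrite gen_parabolic // !inE jJ vj eqxx.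
suff wsj : (w * s_ j)%g \in parabolic (zeros J v).
  by rewrite -(mulgK (s_ j) w) groupM ?groupV.
rewrite wE e; apply: (IH t') => //; first exact: leq_trans st tl.
  by move=> k /tt'/tJ.
by rewrite -e -wE repM -mulmxA gen_fix.
Qed.

Lemma zeros_stab J w v : w \in parabolic (zeros J v) -> rW w *m v = v.
Proof.
move/parabolic_fix; apply => k; rewrite inE => /andP[_ /eqP //].
Qed.

(** The h that make v dominant form a single coset of the stabilizer of a dominant point. This lets
    a face be averaged over all ways of moving it into the cone. *)
Lemma sum_dominant_conj J v :
  \sum_(h in parabolic J | dominant J (rW h *m v))
    #|parabolic (zeros J (rW h *m v))|%:R^-1 = 1 :> R.
Proof.
have [h0 h0J d0] := dominant_conj J v; set v0 := rW h0 *m v in d0.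
have zJ : zeros J v0 \subset J by apply/subsetP => k; rewrite inE => /andP[].
have dom h : (h \in parabolic J) && dominant J (rW h *m v) =
    ((h * h0^-1)%g \in parabolic (zeros J v0)).
  have hv : rW h *m v = rW (h * h0^-1)%g *m v0.
    by rewrite /v0 mulmxA -repM mulgKV.
  apply/andP/idP => [[hJ dh]|hz].
    by apply: parabolic_dominant; rewrite // ?groupM ?groupV // -hv.
  split; last by rewrite hv (zeros_stab hz).
  by rewrite -(mulgKV h0 h) groupM // (subsetP (parabolicS zJ)).
rewrite (eq_bigl _ _ dom) (eq_bigr (fun=> #|parabolic (zeros J v0)|%:R^-1)); last first.
  move=> h; rewrite -dom => /andP[hJ dh]; congr (#|parabolic (zeros J _)|%:R^-1).
  have := dom h; rewrite hJ dh => /esym/zeros_stab; rewrite repM /v0 -mulmxA.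
  by rewrite (mulmxA _ (rW h0)) repVK mul1mx.
rewrite (reindex_inj (mulIg h0)) /=.
transitivity (\sum_(h in parabolic (zeros J v0)) #|parabolic (zeros J v0)|%:R^-1 : R).
  by apply: eq_bigl => h; rewrite mulgK.
by rewrite sumr_const -[LHS]mulr_natl mulfV // pnatr_eq0 -lt0n cardG_gt0.
Qed.

End Faces.

(** * Flats and the weighted count of faces *)

Section Counting.
Variables (R : realType) (n : nat) (W : finGroupType) (C : coxeter_data R n W).
Implicit Types (i j k : 'I_n) (g h u w : W) (v : 'cV[R]_n) (J K L : {set 'I_n}).

Local Notation B := (cx_gram C).
Local Notation rW := (cx_rep C).
Local Notation Phi := (cx_root C).
Local Notation alpha := (tnth (cx_simple C)).
Local Notation ip := (inner (cx_gram C)).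
Local Notation parabolic := (parabolic C).
Local Notation rho := (rho C).
Local Notation dominant := (dominant C).
Local Notation zeros := (zeros C).

(* The flats [Fix w] and [u K^perp] are represented by the row spaces of their
   annihilators [moved w] and [wall u K]. *)
Definition face K : 'M[R]_n := diag_mx (\row_i (i \in K)%:R) *m simple_forms C.
Definition wall u K : 'M[R]_n := face K *m rW u^-1%g.
Definition moved w : 'M[R]_n := rW w - 1%:M.

Lemma face_ker K v : (face K *m v = 0) <-> (forall k, k \in K -> ip v (alpha k) = 0).
Proof.
have e k : (face K *m v) k 0 = (k \in K)%:R * ip v (alpha k).
  by rewrite -mulmxA mul_diag_mx [LHS]mxE [X in X * _]mxE simple_formsE ipC.
split=> [h k kK|h]; last first.
  apply/colP => k; rewrite e [RHS]mxE.
  by case: (boolP (k \in K)) => [/h ->|_]; rewrite ?mulr0 ?mul0r.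
by have := e k; rewrite h kK mul1r mxE.
Qed.

Lemma wall_ker u K v :
  (wall u K *m v = 0) <-> (forall k, k \in K -> ip v (rW u *m alpha k) = 0).
Proof.
rewrite /wall -mulmxA; split=> [/face_ker h k kK|h].
  by rewrite ipC ip_actV ipC h.
by apply/face_ker => k kK; rewrite ipC -ip_actV ipC h.
Qed.

Lemma moved_ker w v : moved w *m v = 0 <-> rW w *m v = v.
Proof.
rewrite mulmxBl mul1mx; split=> [/eqP|->]; last by rewrite subrr.
by rewrite subr_eq0 => /eqP.
Qed.

Lemma wall1 K : wall 1 K = face K.
Proof. by rewrite /wall invg1 rep1 mulmx1. Qed.

Lemma rank_face K : \rank (face K) = #|K|.
Proof.
rewrite mxrankMfree; last by rewrite row_free_unit simple_forms_unit.
set D := diag_mx _; have DD : D *m D = D.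
  rewrite /D mul_diag_mx; apply/matrixP => i j; rewrite !mxE.
  by case: (i \in K); rewrite ?mul1r ?mul0r ?mul0rn.
apply/eqP; rewrite -(eqr_nat R) -tr_idem // mxtrace_diag.
rewrite (eq_bigr (fun i => if i \in K then 1 else 0)) => [|i _].
  by rewrite -big_mkcond sumr_const.
by rewrite !mxE; case: ifP.
Qed.

Lemma moved_conj h w : (moved (h * w * h^-1)%g :=: moved w *m rW h^-1%g)%MS.
Proof.
have -> : moved (h * w * h^-1)%g = rW h *m (moved w *m rW h^-1%g).
  by rewrite /moved mulmxBl mul1mx mulmxBr !repM repKV !mulmxA.
apply: eqmxMfull; rewrite row_full_unit; exact: rep_unit.
Qed.

Lemma wallM h u K : wall (h * u) K = wall u K *m rW h^-1%g.
Proof. by rewrite /wall invMg repM mulmxA. Qed.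

Lemma moved_wall_conj h w u K :
  (moved (h * w * h^-1)%g == wall (h * u) K)%MS = (moved w == wall u K)%MS.
Proof.
have hf : row_free (rW h^-1%g) by rewrite row_free_unit rep_unit.
by rewrite wallM !(moved_conj h w) !submxMfree.
Qed.

Lemma moved_rank_conj h w : \rank (moved (h * w * h^-1)%g) = \rank (moved w).
Proof.
by rewrite moved_conj mxrankMfree // row_free_unit rep_unit.
Qed.

Lemma moved_sub_face K w : w \in parabolic K -> (moved w <= face K)%MS.
Proof.
move=> wK; apply: sub_of_ker => v /face_ker h.
by apply/moved_ker; apply: parabolic_fix wK h.
Qed.

(** Such a w fixes the dominant point [rho K], whose stabilizer is generated by the simple
    reflections in [K]. *)
Lemma moved_face_parabolic K w : (moved w <= face K)%MS -> w \in parabolic K.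
Proof.
move=> h; rewrite -(zeros_rho C K).
have fr : rW w *m rho K = rho K.
  apply/moved_ker; apply: ker_of_sub h _; apply/face_ker => k kK.
  by rewrite ip_rho kK.
by apply: parabolic_dominant; rewrite ?fr ?dominant_rho // parabolicT.
Qed.

(** If [alpha k] is orthogonal to the interior point of the face, u^-1 alpha_k is a combination of
    [L], so [alpha k] is orthogonal to the whole flat. *)
Lemma wall_rho u L k v : ip (rW u *m rho L) (alpha k) = 0 ->
  wall u L *m v = 0 -> ip v (alpha k) = 0.
Proof.
rewrite ip_actV => e /wall_ker h.
have br : rW u^-1%g *m alpha k \in Phi by rewrite root_act ?alpha_root.
rewrite ipC -(ip_act C u^-1%g) (co_sum C (rW u^-1%g *m alpha k)) ipC ip_sumr.
rewrite big1 // => i _; rewrite ipZr.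
have [iL|iL] := boolP (i \in L); last by rewrite (rho_root_eq0 br e) ?mul0r.
by rewrite ip_actV invgK h ?mulr0.
Qed.

Lemma wall_rho_fix u L : wall u L *m (rW u *m rho L) = 0.
Proof.
by apply/wall_ker => k kL; rewrite ip_act ip_rho kL.
Qed.

(* The face [u C_L] inside the [J]-dominant cone lies in the flat of exactly
   one standard [K] contained in [J], if any. *)
Lemma zeros_wall J K u L : K \subset J -> (wall u L == face K)%MS ->
  zeros J (rW u *m rho L) = K.
Proof.
move=> KJ /andP[wf fw]; apply/setP => j; rewrite inE; apply/andP/idP.
  case=> jJ /eqP e.
  have : ip (rho K) (alpha j) = 0.
    apply: wall_rho e _; apply: ker_of_sub wf _.
    by apply/face_ker => k kK; rewrite ip_rho kK.
  by rewrite ip_rho => /eqP; rewrite pnatr_eq0 eqb0 negbK.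
move=> jK; split; first exact: (subsetP KJ).
by apply/eqP; move: (j) jK; apply/face_ker; apply: ker_of_sub fw (wall_rho_fix u L).
Qed.

(** As w fixes a J-dominant point it lies in W_K, so Fix w contains K^perp; conversely every root of
    [K] vanishes on the flat of the face, which is Fix w. *)
Lemma moved_wall_zeros J u L w : w \in parabolic J -> dominant J (rW u *m rho L) ->
    (moved w == wall u L)%MS -> let K := zeros J (rW u *m rho L) in
  (wall u L == face K)%MS /\ (moved w == face K)%MS.
Proof.
move=> wJ dp /andP[mw wm] K.
have wp : rW w *m (rW u *m rho L) = rW u *m rho L.
  by apply/moved_ker; apply: ker_of_sub mw (wall_rho_fix u L).
have wK : w \in parabolic K by apply: parabolic_dominant; rewrite ?wp.
have fw : (face K <= wall u L)%MS.
  apply: sub_of_ker => v hv; apply/face_ker => k; rewrite inE => /andP[_ /eqP e].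
  exact: wall_rho e hv.
have mK := moved_sub_face wK.
by rewrite (submx_trans wm mK) fw mK (submx_trans fw wm).
Qed.

(** The pairs (L, u) and (L, u h) with h in W_L describe the same face, so this weight counts each
    face once. Thus [chambers w] is the number of faces spanning Fix w, and [cone_chambers J K] the
    number of those spanning K^perp in the J-dominant cone. *)
Definition weight L : R := #|parabolic L|%:R^-1.

Lemma weight_gt0 L : 0 < weight L.
Proof. by rewrite invr_gt0 ltr0n cardG_gt0. Qed.

Definition chambers w : R :=
  \sum_(p : {set 'I_n} * W | (moved w == wall p.2 p.1)%MS) weight p.1.

Definition cone_chambers J K : R :=
  \sum_(p : {set 'I_n} * W |
     dominant J (rW p.2 *m rho p.1) && (wall p.2 p.1 == face K)%MS) weight p.1.

Lemma chambers_conj h w : chambers (h * w * h^-1)%g = chambers w.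
Proof.
rewrite /chambers (reindex_inj (h := fun p => (p.1, h * p.2)%g)).
  by apply: eq_bigl => p; rewrite moved_wall_conj.
by move=> [L u] [L' u'] /= [-> /mulgI ->].
Qed.

Lemma chambers_face K w : (moved w == face K)%MS -> chambers w = cone_chambers set0 K.
Proof.
move=> mK; apply: eq_bigl => p.
have -> : dominant set0 (rW p.2 *m rho p.1) by apply/dominantP => j; rewrite inE.
move/eqmxP: mK => mK; rewrite /= !mK; exact: andbC.
Qed.

(** A generic point of Fix w is orthogonal only to the roots orthogonal to all of Fix w. Moved into
    the dominant chamber, it lies inside a face spanning the moved fixed space. *)
Lemma chambers_gt0 w : 0 < chambers w.
Proof.
pose E := fixproj rW w.
pose forms := [seq (a^T *m B *m E : 'rV_n) | a <- Phi & a^T *m B *m E != 0].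
have [|v hv] := @avoid_forms R n forms.
  by move=> a /mapP[b]; rewrite mem_filter => /andP[h _] ->.
have [h _ dh] := dominant_conj C setT (E *m v).
pose L := zeros setT (rW h *m (E *m v)).
pose w' := (h * w * h^-1)%g.
have wE : rW w *m (E *m v) = E *m v by rewrite mulmxA rep_fixproj.
have w'fix : rW w' *m (rW h *m (E *m v)) = rW h *m (E *m v).
  by rewrite /w' !repM -!mulmxA (mulmxA (rW h^-1%g)) repVK mul1mx wE.
have w'L : w' \in parabolic L.
  by apply: parabolic_dominant; rewrite ?w'fix ?parabolicT.
have m1 := moved_sub_face w'L.
have m2 : (face L <= moved w')%MS.
  apply: sub_of_ker => z /moved_ker w'z; apply/face_ker => k; rewrite inE => /andP[_ /eqP e].
  pose a := rW h^-1%g *m alpha k.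
  have aP : a \in Phi by rewrite root_act ?alpha_root.
  have aE : a^T *m B *m E = 0.
    apply/eqP; apply: contraT => a0.
    have /hv/negP[] : a^T *m B *m E \in forms.
      by apply/mapP; exists a => //; rewrite mem_filter a0.
    apply/eqP; rewrite [LHS]mx11_scalar.
    have -> : (a^T *m B *m E *m v) 0 0 = ip a (E *m v) by rewrite /inner !mulmxA.
    by rewrite ipC -ip_actV e raddf0.
  have Ez : E *m (rW h^-1%g *m z) = rW h^-1%g *m z.
    apply: fixproj_fix; rewrite -{2}w'z /w' !repM !mulmxA repVK mul1mx //.
  by rewrite -(ip_act C h^-1%g) ipC -/a -Ez /inner mulmxA aE mul0mx mxE.
rewrite -(chambers_conj h) -/w' /chambers (bigD1 (L, 1%g)) /= ?wall1 ?m1 ?m2 //.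
by rewrite ltr_pwDl ?weight_gt0 // sumr_ge0 // => p _; exact/ltW/weight_gt0.
Qed.

Definition cuspidal K : {set W} := [set w | (moved w == face K)%MS].

Lemma cuspidal_parabolic J K w : K \subset J -> w \in cuspidal K -> w \in parabolic J.
Proof.
move=> KJ; rewrite inE => /andP[mK _].
exact: (subsetP (parabolicS C KJ)) (moved_face_parabolic mK).
Qed.

(* Every [w] in the parabolic subgroup is counted once, as the total of the
   weights [1 / chambers w] over the faces spanning [Fix w]; each face is then
   moved into the [J]-dominant cone by its parabolic orbit. *)
Lemma sum_parabolic J (g : nat -> R) :
  \sum_(w in parabolic J) g (\rank (moved w)) = #|parabolic J|%:R *
    \sum_(K : {set 'I_n} | K \subset J)
      cone_chambers J K * (g #|K| * #|cuspidal K|%:R /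
        (cone_chambers set0 K * #|parabolic K|%:R)).
Proof.
pose zr (p : {set 'I_n} * W) := rW p.2 *m rho p.1.
pose F w (p : {set 'I_n} * W) := weight p.1 * g (\rank (moved w)) / chambers w.
pose S := \sum_(w in parabolic J) \sum_(p : {set 'I_n} * W |
   (moved w == wall p.2 p.1)%MS && dominant J (zr p))
     F w p * #|parabolic (zeros J (zr p))|%:R^-1.
have step1 : \sum_(w in parabolic J) g (\rank (moved w)) = #|parabolic J|%:R * S.
  transitivity (\sum_(w in parabolic J) \sum_(p : {set 'I_n} * W |
      (moved w == wall p.2 p.1)%MS) F w p).
    apply: eq_bigr => w _; rewrite /F.
    under eq_bigr => p _ do rewrite -mulrA mulrC.
    rewrite -mulr_sumr -/(chambers w) mulfVK // lt0r_neq0 //; exact: chambers_gt0.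
  (* The factor 1 is inserted as a sum over the h in W_J that make the face J-dominant. *)
  transitivity (\sum_(w in parabolic J) \sum_(p : {set 'I_n} * W |
      (moved w == wall p.2 p.1)%MS) \sum_(h in parabolic J | dominant J (rW h *m zr p))
        F w p * #|parabolic (zeros J (rW h *m zr p))|%:R^-1).
    apply: eq_bigr => w _; apply: eq_bigr => p _.
    by rewrite -mulr_sumr sum_dominant_conj mulr1.
  transitivity (\sum_(h in parabolic J) S); last first.
    by rewrite sumr_const -[LHS]mulr_natl.
  transitivity (\sum_(h in parabolic J) \sum_(w in parabolic J) \sum_(p : {set 'I_n} * W |
      (moved w == wall p.2 p.1)%MS && dominant J (rW h *m zr p))
        F w p * #|parabolic (zeros J (rW h *m zr p))|%:R^-1).
    rewrite [RHS]exchange_big; apply: eq_bigr => w _ /=.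
    rewrite (exchange_big_dep (fun h => h \in parabolic J)) /=; last by move=> p h _ /andP[].
    apply: eq_bigr => h hJ; rewrite hJ /=; exact: eq_bigl.
  apply: eq_bigr => h hJ; rewrite /S.
  (* Conjugating w by h while replacing u by h^-1 u preserves every weight and carries the face
     moved by h to the face itself, so the inner sum is S for every h. *)
  rewrite (reindex_inj (conjg_inj h)) /=.
  apply: eq_big => [w|w wJ]; first by rewrite groupJr.
  have wc : (w ^ h = h^-1 * w * h^-1^-1)%g by rewrite conjgE invgK mulgA.
  rewrite (reindex_inj (h := fun p : {set 'I_n} * W => (p.1, h^-1 * p.2)%g)) /=; last first.
    by move=> [L u] [L' u'] /= [-> /mulgI ->].
  have zrE p : rW h *m zr (p.1, (h^-1 * p.2)%g) = zr p.
    by rewrite /zr /= repM !mulmxA repKV mul1mx.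
  apply: eq_big => [p|p _]; first by rewrite zrE wc moved_wall_conj.
  by rewrite zrE /F /= wc moved_rank_conj chambers_conj.
rewrite step1; congr (_ * _); rewrite /S.
rewrite (exchange_big_dep (fun p => dominant J (zr p))) /=; last by move=> w p _ /andP[].
(* Faces are sorted by the set K of simple roots of J vanishing on them; a face contributes to its K
   only if it spans K^perp. *)
rewrite (partition_big (fun p => zeros J (zr p)) (fun K => K \subset J)) /=; last first.
  by move=> p _; apply/subsetP => k; rewrite inE => /andP[].
apply: eq_bigr => K KJ.
transitivity (\sum_(p : {set 'I_n} * W | dominant J (zr p) && (wall p.2 p.1 == face K)%MS)
  \sum_(w in cuspidal K) weight p.1 * g #|K| / cone_chambers set0 K * #|parabolic K|%:R^-1).
  rewrite [RHS](bigID (fun p => zeros J (zr p) == K)) /= [X in _ = _ + X]big1 ?addr0; last first.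
    by move=> p /andP[/andP[_ /(zeros_wall KJ) ->]]; rewrite eqxx.
  rewrite [LHS](bigID (fun p : {set 'I_n} * W => (wall p.2 p.1 == face K)%MS)) /=.
  rewrite [X in _ + X]big1 ?addr0 => [|p /andP[/andP[dp /eqP zK] nw]]; last first.
    rewrite big1 // => w /andP[wJ /andP[mw _]].
    by have [] := moved_wall_zeros wJ dp mw; rewrite /= zK (negPf nw).
  apply: eq_big => [p|p /andP[/andP[dp /eqP zK] wK]].
    by rewrite andbAC.
  apply: eq_big => [w|w /andP[wJ /andP[mw _]]].
    rewrite dp andbT inE; apply/andP/idP => [[wJ mw]|mK].
      by have [_] := moved_wall_zeros wJ dp mw; rewrite /= zK.
    split; first by apply: (cuspidal_parabolic KJ); rewrite inE.
    by move/eqmxP: wK => wK; rewrite !wK.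
  have [_] := moved_wall_zeros wJ dp mw; rewrite /= zK => mK.
  rewrite /F (chambers_face mK).
  by move/eqmxP: mK => mK; rewrite mK rank_face.
rewrite /cone_chambers mulr_suml; apply: eq_bigr => p _.
rewrite sumr_const -[LHS]mulr_natl invfM -/(gval (parabolic K)); ring.
Qed.
End Counting.

(** * Faces in a cone as elements of [X_set] *)

Section Transport.
Variables (R : realType) (n : nat) (W : finGroupType) (C : coxeter_data R n W).
Implicit Types (i j k l : 'I_n) (g h u w x y : W) (v : 'cV[R]_n) (J K L : {set 'I_n}).

Local Notation rW := (cx_rep C).
Local Notation Phi := (cx_root C).
Local Notation alpha := (tnth (cx_simple C)).
Local Notation ip := (inner (cx_gram C)).
Local Notation pos := (nonneg_comb (cx_simple C)).
Local Notation co i := (coord (cx_simple C) i).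
Local Notation parabolic := (parabolic C).
Local Notation rho := (rho C).
Local Notation dominant := (dominant C).
Local Notation zeros := (zeros C).
Local Notation maps_onto := (maps_onto C).

Lemma alpha_inj : injective alpha.
Proof.
move=> i j e; have := co_alpha C i j; rewrite -e co_alpha eqxx.
by case: eqP => // _ /eqP; rewrite oner_eq0.
Qed.

Lemma maps_ontoP w K L : reflect
  ((forall k, k \in K -> exists2 l, l \in L & rW w *m alpha k = alpha l) /\
   (forall l, l \in L -> exists2 k, k \in K & rW w *m alpha k = alpha l))
  (maps_onto w K L).
Proof.
apply: (iffP andP) => -[h1 h2]; split.
- move=> k kK; have /exists_inP[l lL /eqP e] := forall_inP h1 k kK; by exists l.
- move=> l lL; have /exists_inP[k kK /eqP e] := forall_inP h2 l lL; by exists k.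
- apply/forall_inP => k /h1[l lL e]; apply/exists_inP; exists l => //; exact/eqP.
- apply/forall_inP => l /h2[k kK e]; apply/exists_inP; exists k => //; exact/eqP.
Qed.

Lemma maps_onto_unique w K L L' : maps_onto w K L -> maps_onto w K L' -> L = L'.
Proof.
wlog suff sub : L L' / maps_onto w K L -> maps_onto w K L' -> L \subset L'.
  by move=> h h'; apply/eqP; rewrite eqEsubset !sub.
move=> /maps_ontoP[_ h2] /maps_ontoP[h1 _]; apply/subsetP => l /h2[k /h1[l' lL' e]].
by rewrite e => /alpha_inj <-.
Qed.

Lemma maps_simpleP w K :
  reflect (exists L, maps_onto w K L) (maps_simple C w K).
Proof.
apply: (iffP forall_inP) => [h|[L /maps_ontoP[h _]] k /h[l _ e]]; last first.
  by apply/existsP; exists l; apply/eqP.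
exists [set l | [exists k in K, rW w *m alpha k == alpha l]].
apply/maps_ontoP; split=> [k kK|l]; last first.
  by rewrite inE => /exists_inP[k kK /eqP e]; exists k.
have /existsP[l e] := h k kK; exists l; last exact/eqP.
by rewrite inE; apply/exists_inP; exists k.
Qed.

Lemma maps_onto1 K : maps_onto 1 K K.
Proof. by apply/maps_ontoP; split=> k kK; exists k; rewrite // rep1 mul1mx. Qed.

Lemma maps_ontoV w K L : maps_onto w K L -> maps_onto w^-1 L K.
Proof.
move=> /maps_ontoP[h1 h2]; apply/maps_ontoP; split=> [l /h2[k kK e]|k /h1[l lL e]].
  by exists k; rewrite // -e mulmxA repVK mul1mx.
by exists l; rewrite // -e mulmxA repVK mul1mx.
Qed.

Lemma maps_ontoM w w' K L M : maps_onto w K L -> maps_onto w' L M ->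
  maps_onto (w' * w) K M.
Proof.
move=> /maps_ontoP[h1 h2] /maps_ontoP[h3 h4].
apply/maps_ontoP; split=> [k /h1[l /h3[m mM e'] e]|m /h4[l /h2[k kK e] e']].
  by exists m; rewrite // repM -mulmxA e.
by exists k; rewrite // repM -mulmxA e.
Qed.

Lemma maps_onto_card w K L : maps_onto w K L -> #|K| = #|L|.
Proof.
wlog suff sub : w K L / maps_onto w K L -> (#|L| <= #|K|)%N.
  by move=> h; apply/eqP; rewrite eqn_leq (sub _ _ _ h) (sub _ _ _ (maps_ontoV h)).
move=> /maps_ontoP[_ h].
pose phi k := odflt k [pick l | rW w *m alpha k == alpha l].
suff /subset_leq_card/leq_trans : L \subset [set phi k | k in K].
  by apply; apply: leq_imset_card.
apply/subsetP => l /h[k kK e]; apply/imsetP; exists k => //.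
rewrite /phi; case: pickP => [l' /eqP e'|/(_ l)]; last by rewrite e eqxx.
by apply: alpha_inj; rewrite -e.
Qed.

Lemma pos_of_rho v : v \in Phi -> 0 <= ip (rho set0) v -> pos v.
Proof.
move=> vP h; have := root_pm vP; case/orP => // pn.
have e : ip (rho set0) v = 0.
  apply/eqP; rewrite eq_le h andbT -oppr_ge0 -ipNr; exact: rho_pos_ge0.
have v0 := root_neq0 vP; case/eqP: v0; apply: co_eq0 => i.
by apply: (rho_root_eq0 vP e); rewrite inE.
Qed.

Lemma X_setP J x : reflect (forall j, j \in J -> pos (rW x *m alpha j)) (x \in X_set C J).
Proof.
have rt j : rW x *m alpha j \in Phi by rewrite root_act ?alpha_root.
apply: (iffP idP) => [|h].
  rewrite inE => /eqP/setP h j jJ; have := h j; rewrite !inE jJ andbT.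
  by move/negbT; rewrite -[cx_act _ _ _]/(rW x *m alpha j) negE // negbK.
rewrite inE; apply/eqP/setP => j; rewrite !inE.
apply/negP => /andP[nj /h pj]; move: nj.
by rewrite -[cx_act _ _ _]/(rW x *m alpha j) negE // pj.
Qed.

(* A simple root of [span K] is a nonnegative combination of the positive
   roots [y alpha_l], each of which is a nonnegative combination of [K]. *)
Lemma simple_match y L K :
    (forall l, l \in L -> pos (rW y *m alpha l)) ->
    (forall k i, k \in K -> i \notin L -> co i (rW y^-1%g *m alpha k) = 0) ->
  forall k, k \in K -> exists2 l, l \in L & rW y *m alpha l = alpha k.
Proof.
move=> ypos cK k kK; pose b := rW y^-1%g *m alpha k.
have bP : b \in Phi by rewrite root_act ?alpha_root.
have bE : alpha k = \sum_l co l b *: (rW y *m alpha l).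
  rewrite -[LHS]mul1mx -(rep1 rW) -(mulgV y) repM -mulmxA -/b {1}(co_sum C b).
  by rewrite mulmx_sumr; apply: eq_bigr => l _; rewrite -scalemxAr.
have coE i : co i (alpha k) = \sum_l co l b * co i (rW y *m alpha l).
  by rewrite {1}bE linear_sum; apply: eq_bigr => l _; rewrite linearZ.
have ypos' l : co l b != 0 -> pos (rW y *m alpha l).
  move=> cl; apply: ypos; apply: contraNT cl => lL; exact/eqP/cK.
have bpos : pos b.
  case/orP: (root_pm bP) => // /posP bn.
  have : co k (alpha k) <= 0.
    rewrite coE sumr_le0 // => l _; have [->|/ypos'/posP p] := eqVneq (co l b) 0.
      by rewrite mul0r.
    by apply: mulr_le0_ge0; rewrite ?p // -oppr_ge0 -coN.
  by rewrite co_alpha eqxx ler10.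
have [l cl] : exists l, co l b != 0.
  apply/existsP; apply: contraT => /existsPn h; have := root_neq0 bP.
  by rewrite (co_eq0 (C := C) (v := b)) ?eqxx // => l; have := h l; rewrite negbK => /eqP.
exists l; first by apply: contraNT cl => lL; apply/eqP/cK.
have only i : i != k -> co i (rW y *m alpha l) = 0.
  move=> ik; have := coE i; rewrite co_alpha (negPf ik) => /esym/eqP.
  rewrite psumr_eq0 => [/allP/(_ l (mem_index_enum _))|l' _]; last first.
    have [->|/ypos'/posP p] := eqVneq (co l' b) 0; first by rewrite mul0r.
    by rewrite mulr_ge0 //; apply/posP.
  by rewrite mulf_eq0 (negPf cl) => /eqP.
have yP : rW y *m alpha l \in Phi by rewrite root_act ?alpha_root.
have e : rW y *m alpha l = co k (rW y *m alpha l) *: alpha k.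
  rewrite {1}(co_sum C (rW y *m alpha l)) (bigD1 k) //= big1 ?addr0 // => i ik.
  by rewrite only ?scale0r.
have [_ red _] := cx_rootP C; move: (yP); rewrite e red ?alpha_root //.
case/orP => /eqP ck; first by rewrite ck scale1r.
have /posP/(_ k) := ypos' l cl; rewrite ck oppr_ge0 ler10 //.
Qed.

Lemma face_parabolic h L v : h \in parabolic L ->
  face C L *m (rW h *m v) = 0 <-> face C L *m v = 0.
Proof.
have main g (z : 'cV_n) : g \in parabolic L -> face C L *m z = 0 -> face C L *m (rW g *m z) = 0.
  by move=> gL fz; rewrite (parabolic_fix gL) //; apply/face_ker.
move=> hL; split; last exact: main.
move/(main h^-1%g); rewrite groupV => /(_ hL).
by rewrite (mulmxA (rW h^-1%g)) repVK mul1mx.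
Qed.

Lemma wall_parabolic x u L v : (x * u)%g \in parabolic L ->
  wall C u L *m v = 0 <-> face C L *m (rW x *m v) = 0.
Proof.
move=> hL; rewrite /wall -mulmxA.
have -> : rW u^-1%g *m v = rW (x * u)^-1%g *m (rW x *m v).
  by rewrite invMg repM -mulmxA (mulmxA (rW x^-1%g)) repVK mul1mx.
by apply: face_parabolic; rewrite groupV.
Qed.

(** The face u C_L equals x^-1 C_L, and x keeps the roots of [J] positive, so its points pair
    nonnegatively with them. *)
Lemma transport_cone J K L x u : x \in X_set C J -> maps_onto x K L ->
    (x * u)%g \in parabolic L ->
  dominant J (rW u *m rho L) && (wall C u L == face C K)%MS.
Proof.
move=> /X_setP xJ /maps_ontoP[xK xL] xuL; apply/andP; split.
  apply/dominantP => j jJ.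
  have -> : rW u *m rho L = rW x^-1%g *m rho L.
    have : rW (x * u)%g *m rho L = rho L.
      by apply: (parabolic_fix xuL) => l lL; rewrite ip_rho lL.
    by rewrite repM -mulmxA => {2}<-; rewrite mulmxA repVK mul1mx.
  by rewrite ip_actV invgK rho_pos_ge0 ?xJ.
have flat v : face C L *m (rW x *m v) = 0 <-> face C K *m v = 0.
  split=> /face_ker h; apply/face_ker.
    by move=> k /xK[l lL e]; rewrite -(ip_act C x) e h.
  by move=> l /xL[k kK <-]; rewrite ip_act h.
apply/andP; split; apply: sub_of_ker => v.
  by move/flat/(wall_parabolic v xuL).
by move/(wall_parabolic v xuL)/flat.
Qed.

(** The quotient of the two elements lies in W_L and sends [L] to simple roots; having no descent in
    [L], it is trivial. *)
Lemma transport_unique J K L x x' u : x \in X_set C J -> x' \in X_set C J ->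
  maps_onto x K L -> maps_onto x' K L ->
  (x * u)%g \in parabolic L -> (x' * u)%g \in parabolic L -> x = x'.
Proof.
move=> _ _ /maps_ontoP[_ xL] /maps_ontoP[x'K _] xu x'u.
pose z := (x' * u * (x * u)^-1)%g.
have zL : z \in parabolic L by rewrite groupM ?groupV.
have zE : z = (x' * x^-1)%g by rewrite /z invMg mulgA mulgK.
apply/esym/eqP; rewrite eq_mulgV1 -zE; apply: contraT => z1.
have [l /xL[k /x'K[l' _ e'] e]] := parabolic_descent zL z1.
rewrite zE repM -mulmxA -e (mulmxA (rW x^-1%g)) repVK mul1mx e'.
by rewrite negE ?alpha_root // pos_alpha.
Qed.

(** In the coset W_L u^-1 there is an x whose inverse keeps [L] positive: choose h making h u^-1 of
    an interior point L-dominant. As x carries K^perp to L^perp, positivity forces it to match [K]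
    with [L], and dominance of the face puts it in X_J. *)
Lemma transport_exists J K L u : K \subset J ->
    dominant J (rW u *m rho L) -> (wall C u L == face C K)%MS ->
  exists x, [/\ x \in X_set C J, maps_onto x K L & (x * u)%g \in parabolic L].
Proof.
move=> KJ du wK; have [h hL dh] := dominant_conj C L (rW u^-1%g *m rho set0).
pose x := (h * u^-1)%g; have xu : (x * u)%g \in parabolic L by rewrite /x mulgKV.
have flat v : face C L *m (rW x *m v) = 0 <-> face C K *m v = 0.
  have /andP[w1 w2] := wK; split.
    by move/(wall_parabolic v xu); apply: ker_of_sub.
  by move=> fv; apply/(wall_parabolic v xu); apply: ker_of_sub fv.
have uE : rW u *m rho L = rW x^-1%g *m rho L.
  have : rW (x * u)%g *m rho L = rho L.
    by apply: (parabolic_fix xu) => l lL; rewrite ip_rho lL.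
  by rewrite repM -mulmxA => {2}<-; rewrite mulmxA repVK mul1mx.
have posL l : l \in L -> pos (rW x^-1%g *m alpha l).
  move=> lL; apply: pos_of_rho; first by rewrite root_act ?alpha_root.
  rewrite ipC ip_actV invgK ipC /x repM -mulmxA.
  by move/dominantP: dh; apply.
have rho0 M : face C M *m rho M = 0.
  by apply/face_ker => i iM; rewrite ip_rho iM.
have coL k i : k \in K -> i \notin L -> co i (rW x *m alpha k) = 0.
  move=> kK iL; apply: (@rho_root_eq0 _ _ _ C L) iL; first by rewrite root_act ?alpha_root.
  rewrite ipC ip_actV ipC; move: (k) kK; apply/face_ker/flat.
  by rewrite mulmxA repKV mul1mx.
have coK l i : l \in L -> i \notin K -> co i (rW x^-1%g *m alpha l) = 0.
  move=> lL iK; apply: (@rho_root_eq0 _ _ _ C K) iK; first by rewrite root_act ?alpha_root.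
  rewrite ipC ip_actV invgK ipC; move: (l) lL; apply/face_ker/flat.
  exact: rho0.
have xV : ((x^-1)^-1 = x)%g := invgK x.
have mK k : k \in K -> exists2 l, l \in L & rW x *m alpha k = alpha l.
  move=> kK; have [|l lL e] := @simple_match x^-1%g L K posL _ k kK.
    by move=> k' i; rewrite xV; apply: coL.
  by exists l; rewrite // -e mulmxA repKV mul1mx.
have mL l : l \in L -> exists2 k, k \in K & rW x *m alpha k = alpha l.
  apply: simple_match => [k /mK[l' _ ->]|]; first exact: pos_alpha.
  exact: coK.
exists x; split=> //; last by apply/maps_ontoP.
apply/X_setP => j jJ; have rt : rW x *m alpha j \in Phi by rewrite root_act ?alpha_root.
case/orP: (root_pm rt) => // pn.
have e : ip (rW u *m rho L) (alpha j) = 0.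
  apply/eqP; rewrite eq_le (dominantP _ _ _ du) // andbT uE ip_actV invgK.
  by rewrite -oppr_ge0 -ipNr rho_pos_ge0.
have : j \in zeros J (rW u *m rho L) by rewrite inE jJ e eqxx.
by rewrite (zeros_wall KJ wK) => /mK[l _ ->]; apply: pos_alpha.
Qed.

(** Each pair (L, u) counted on the left belongs to exactly one x, while each x accounts for the
    |W_L| pairs with L = x(K), of total weight 1. *)
Lemma cone_chambersE J K : K \subset J ->
  cone_chambers C J K = #|[set x in X_set C J | maps_simple C x K]|%:R.
Proof.
move=> KJ; pose Q x (p : {set 'I_n} * W) :=
  maps_onto x K p.1 && ((x * p.2)%g \in parabolic p.1).
transitivity (\sum_(p : {set 'I_n} * W |
     dominant J (rW p.2 *m rho p.1) && (wall C p.2 p.1 == face C K)%MS)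
     \sum_(x in X_set C J | Q x p) weight C p.1).
  apply: eq_bigr => -[L u] /= /andP[du wK].
  have [x [xJ xK xu]] := transport_exists KJ du wK.
  rewrite (big_pred1 x) // => x'; apply/andP/eqP => [[x'J /andP[x'K x'u]]|->].
    exact: (transport_unique x'J xJ x'K xK x'u xu).
  by rewrite /Q /= xK xu.
rewrite (exchange_big_dep (fun x => x \in [set x in X_set C J | maps_simple C x K])) /=; last first.
  move=> p x _ /andP[xJ /andP[xK _]]; rewrite inE xJ /=.
  by apply/maps_simpleP; exists p.1.
rewrite -sumr_const; apply: eq_bigr => x; rewrite inE => /andP[xJ /maps_simpleP[L xK]].
rewrite (eq_bigl (fun p => (p.1 == L) && ((x * p.2)%g \in parabolic p.1))); last first.
  move=> [L' u] /=; rewrite xJ /Q /=; apply/andP/andP => [[_ /andP[xK' xu]]|[/eqP-> xu]].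
    by rewrite (maps_onto_unique xK' xK) eqxx -(maps_onto_unique xK' xK).
  by rewrite xK xu (transport_cone xJ xK xu).
rewrite -(pair_big_dep (fun L' => L' == L) (fun L' u => (x * u)%g \in parabolic L')
  (fun L' _ => weight C L')) /= big_pred1_eq (reindex_inj (mulgI x^-1%g)) /=.
transitivity (\sum_(u in parabolic L) weight C L).
  by apply: eq_bigl => u; rewrite mulKVg.
by rewrite sumr_const -[LHS]mulr_natl mulfV // pnatr_eq0 -lt0n cardG_gt0.
Qed.
End Transport.

(** * The coefficient of the identity *)

Section IdentityCoefficient.
Variables (R : realType) (n : nat) (W : finGroupType) (C : coxeter_data R n W).
Implicit Types (J K L : {set 'I_n}) (w : W).

Local Notation parabolic := (parabolic C).
Local Notation equivalent := (equivalent C).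
Local Notation eqclass := (eqclass C).
Local Notation mu := (mu C).
Local Notation beta := (beta C).
Local Notation cone_chambers := (cone_chambers C).

Lemma equivalent_rel : equivalence_rel equivalent.
Proof.
have refl K : equivalent K K by apply/existsP; exists 1%g; apply: maps_onto1.
have sym K L : equivalent K L -> equivalent L K.
  by case/existsP=> w h; apply/existsP; exists w^-1%g; apply: maps_ontoV.
have trans K L M : equivalent K L -> equivalent L M -> equivalent K M.
  case/existsP=> w h /existsP[w' h']; apply/existsP; exists (w' * w)%g.
  exact: maps_ontoM h h'.
move=> K L M; split; first exact: refl.
move=> KL; apply/idP/idP => h; first exact: trans (sym _ _ KL) h.
exact: trans KL h.
Qed.

Lemma equivalent_card K L : equivalent K L -> #|K| = #|L|.
Proof. by case/existsP=> w /maps_onto_card. Qed.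

Lemma eqclass_gt0 K : (0 < #|eqclass K|)%N.
Proof.
apply/card_gt0P; exists K; rewrite inE.
by have [] := equivalent_rel K K K.
Qed.

Lemma sum_eqclasses (F : {set 'I_n} -> {set {set 'I_n}} -> R) :
  \sum_(lambda in eqclasses C) \sum_(J in lambda) F J lambda =
  \sum_J F J (eqclass J).
Proof.
have eqr : {in [set: {set 'I_n}] & &, equivalence_rel equivalent}.
  by move=> K L M _ _ _; apply: equivalent_rel.
have part := equivalence_partitionP eqr; have [_ tI _] := and3P part.
rewrite [RHS](partition_big eqclass (mem (eqclasses C))) /= => [|J _]; last first.
  apply/imsetP; exists J; rewrite ?inE //.
  by apply/setP => K; rewrite !inE.
apply: eq_bigr => lambda /imsetP[K _ lE].
have lK : lambda = eqclass K by rewrite lE; apply/setP => L; rewrite !inE.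
have classE J : (J \in lambda) = (eqclass J == lambda).
  have [rK hK] := equivalent_rel K J J; have [rJ _] := equivalent_rel J J J.
  rewrite lK inE; apply/idP/eqP => [KJ|/setP/(_ J)]; last by rewrite !inE rJ => <-.
  by apply/setP => M; rewrite !inE; have [_ /(_ KJ)] := equivalent_rel K J M.
rewrite (eq_bigl _ _ classE); apply: eq_bigr => J /eqP -> //.
Qed.

Lemma class_norm_eqclass J : Defs.class_norm (eqclass J) = #|J|.
Proof.
rewrite /Defs.class_norm; case: pickP => [K|/(_ J)].
  by rewrite inE => /equivalent_card.
by rewrite inE; have [->] := equivalent_rel J J J.
Qed.

Lemma mu_diag_neq0 J : mu J J != 0.
Proof.
rewrite /mu subxx mulf_neq0 ?invr_eq0 ?pnatr_eq0 -?lt0n ?eqclass_gt0 //.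
apply/card_gt0P; exists 1%g; rewrite inE; apply/andP; split.
  by apply/X_setP => j _; rewrite rep1 mul1mx pos_alpha.
by apply/maps_simpleP; exists J; apply: maps_onto1.
Qed.

(** Stated for a family [P] closed under subsets so that one induction serves both the invertibility
    of the matrix and the triangularity of its inverse. *)
Lemma mu_triangular (v : {set 'I_n} -> R) (P : pred {set 'I_n}) :
    (forall J K, P J -> K \subset J -> P K) ->
    (forall J, P J -> \sum_K v K * mu K J = 0) ->
  forall J, P J -> v J = 0.
Proof.
move=> Pdown h J; have [l] := ubnP #|J|; elim: l J => // l IH J.
rewrite ltnS => Jl PJ; have := h J PJ; rewrite (bigD1 J) //= big1 => [|K KJ].
  move/eqP; rewrite addr0 mulf_eq0 (negPf (mu_diag_neq0 J)) orbF.
  by move/eqP.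
have [sKJ|nKJ] := boolP (K \subset J); last by rewrite /mu (negPf nKJ) mulr0.
rewrite IH ?mul0r //; last exact: Pdown PJ sKJ.
by apply: leq_trans Jl; apply: proper_card; rewrite properEneq KJ.
Qed.

Lemma mul_mu_mx (v : 'rV[R]_#|{: {set 'I_n}}|) J :
  (v *m mu_mx C) 0 (enum_rank J) = \sum_K v 0 (enum_rank K) * mu K J.
Proof.
rewrite mxE (reindex (@enum_rank {set 'I_n})) /=; last first.
  by apply: onW_bij; apply: enum_rank_bij.
by apply: eq_bigr => K _; rewrite mxE !enum_rankK.
Qed.

Lemma mu_mx_unit : mu_mx C \in unitmx.
Proof.
rewrite -row_free_unit -kermx_eq0; apply/eqP/row_matrixP => i; rewrite row0.
have : row i (kermx (mu_mx C)) *m mu_mx C = 0 by rewrite -row_mul mulmx_ker row0.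
move: (row i _) => v vm; apply/rowP => a; rewrite [RHS]mxE -(enum_valK a).
apply: (mu_triangular (v := fun K => v 0 (enum_rank K)) (P := predT)) => // J _.
by rewrite -mul_mu_mx vm mxE.
Qed.

Lemma beta_eq0 K J : ~~ (K \subset J) -> beta K J = 0.
Proof.
apply: (mu_triangular (v := beta K) (P := fun J => ~~ (K \subset J))) => [I L nI LI|I nI].
  by apply: contra nI => KL; apply: subset_trans LI.
have := mul_mu_mx (row (enum_rank K) (invmx (mu_mx C))) I.
rewrite -row_mul mulVmx ?mu_mx_unit // !mxE.
rewrite (inj_eq enum_rank_inj); case: eqP nI => [->|_ _]; first by rewrite subxx.
by rewrite mulr0n => /esym e; rewrite -[RHS]e; apply: eq_bigr => L _; rewrite mxE.
Qed.

(** The identity lies in every X_K, so each x_K has coefficient 1 there. Evaluating the e_J at the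
    identity thus multiplies the all-ones row by the inverse matrix. *)
Lemma e_elt1 (c : {set 'I_n} -> R) :
  (forall J, \sum_(K : {set 'I_n} | K \subset J) mu K J * c K = 1) ->
  forall J, e_elt C J 1%g = c J.
Proof.
move=> hc J.
have x1 K : x_elt C K 1%g = 1.
  rewrite /x_elt sum_ffunE (bigD1 1%g) /=; last first.
    by apply/X_setP => j _; rewrite rep1 mul1mx pos_alpha.
  rewrite ffunE eqxx big1 ?addr0 // => w /andP[_ w1].
  by rewrite ffunE eq_sym (negPf w1).
pose u : 'rV[R]_#|{: {set 'I_n}}| := \row_a c (enum_val a).
have uE : u *m mu_mx C = const_mx 1.
  apply/rowP => a; rewrite -(enum_valK a) mul_mu_mx [RHS]mxE -[RHS](hc (enum_val a)).
  rewrite [RHS]big_mkcond; apply: eq_bigr => K _; rewrite mxE enum_rankK mulrC.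
  by rewrite /mu; case: ifP; rewrite ?mul0r.
have cE : c J = ((const_mx 1 : 'rV_#|{: {set 'I_n}}|) *m invmx (mu_mx C)) 0 (enum_rank J).
  by rewrite -uE mulmxK ?mu_mx_unit // mxE enum_rankK.
rewrite cE mxE (reindex (@enum_rank {set 'I_n})) /=; last first.
  by apply: onW_bij; apply: enum_rank_bij.
rewrite /e_elt sum_ffunE big_mkcond; apply: eq_bigr => K _.
rewrite mxE mul1r; case: ifP => [_|/negbT/beta_eq0 <- //].
by rewrite ffunE x1 -[_ *: _]/(_ * _) mulr1.
Qed.

Lemma e_elt1E J : e_elt C J 1%g =
  #|eqclass J|%:R * (#|cuspidal C J|%:R / (cone_chambers set0 J * #|parabolic J|%:R)).
Proof.
move: J; apply: e_elt1 => J.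
(* With constant weight function the left side is |W_J|, so the face count is the defining linear
   system of the c_K; the class size cancels the denominator of [mu]. *)
have := sum_parabolic C J (fun=> 1); rewrite sumr_const => e.
have P0 : #|parabolic J|%:R != 0 :> R by rewrite pnatr_eq0 -lt0n cardG_gt0.
apply: (mulfI P0); rewrite mulr1 [RHS]e; congr (_ * _); apply: eq_bigr => K KJ.
rewrite /mu KJ (cone_chambersE C KJ) mul1r [LHS]mulrA divfK //.
by rewrite pnatr_eq0 -lt0n eqclass_gt0.
Qed.

(** The same face count for J = Pi, with the weight x^-(codim Fix w). Only the identity has no
    descent, so the dominant chamber has exactly one face spanning each K^perp. *)
Lemma M_elt1 (x : R) :
  M_elt C x 1%g = #|W|%:R^-1 * \sum_w x ^- \rank (moved C w).
Proof.
have WT : parabolic setT :=: [set: W]%g by apply/setP => w; rewrite parabolicT inE.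
have := sum_parabolic C setT (fun k => x ^- k).
rewrite (eq_bigl predT) => [|w]; last by rewrite parabolicT.
move=> ->; rewrite WT cardsT mulKf; last first.
  by rewrite pnatr_eq0 -lt0n; apply/card_gt0P; exists 1%g.
rewrite /M_elt sum_ffunE.
transitivity (\sum_(lambda in eqclasses C) \sum_(J in lambda)
    x ^- Defs.class_norm lambda * (#|lambda|%:R^-1 * e_elt C J 1%g)).
  apply: eq_bigr => lambda _; rewrite ffunE sum_ffunE scaler_sumr.
  by apply: eq_bigr => J _; rewrite ffunE.
rewrite (sum_eqclasses (fun J lambda =>
  x ^- Defs.class_norm lambda * (#|lambda|%:R^-1 * e_elt C J 1%g))).
apply: eq_big => [J|J _]; first by rewrite subsetT.
rewrite class_norm_eqclass e_elt1E mulKf ?pnatr_eq0 -?lt0n ?eqclass_gt0 //.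
rewrite (cone_chambersE C (subsetT J)).
rewrite (_ : [set w in X_set C setT | maps_simple C w J] = [set 1%g]).
  by rewrite cards1 mul1r mulrA.
apply/setP => w; rewrite !inE; apply/andP/eqP => [[wX _]|->].
  apply/eqP; apply: contraT => w1.
  have [j _] := parabolic_descent (parabolicT C w) w1.
  have /X_setP/(_ j (in_setT j)) pj : w \in X_set C setT by rewrite inE.
  by rewrite negE ?pj // root_act ?alpha_root.
split; last by apply/maps_simpleP; exists J; apply: maps_onto1.
suff : 1%g \in X_set C setT by rewrite inE.
by apply/X_setP => j _; rewrite rep1 mul1mx pos_alpha.
Qed.
End IdentityCoefficient.

Theorem theorem3 (R : realType) (n : nat) (W : finGroupType)
    (C : coxeter_data R n W) (m : 'I_n -> nat) (hm : are_exponents C m)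
    (x : R) (hx : x != 0) :
  M_elt C x 1%g = (\prod_(i < n) (x + (m i)%:R)) / (x ^+ n * #|W|%:R).
Proof.
have [f [finv fgen _] fhom] := hm.
have f_inv i : rep_invariant (cx_rep C) (tnth f i) by move=> w; apply: finv.
have f_gen p : rep_invariant (cx_rep C) p -> exists g : {mpoly R[n]}, p = g \mPo f.
  by move=> pinv; apply: fgen.
rewrite -(sum_pow_rank_fix f_inv f_gen fhom (@rep_inj _ _ _ C)) M_elt1.
rewrite invfM mulrA mulr_suml mulrC; congr (_ * _); apply: eq_bigr => w _.
have -> : x ^+ n = x ^+ (n - \rank (moved C w)) * x ^+ \rank (moved C w).
  by rewrite -exprD subnK // rank_leq_row.
by rewrite rank_fixproj invfM mulrA mulfV ?mul1r ?expf_neq0.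
Qed.
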